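(* Let $2\le p<+\infty$ and let $f\in H^p\setminus\{0\}$. Let $M(y)=\int_{-\infty}^{+\infty}|f(x+iy)|^p\,dx$ for $y>0$. Let $\varphi(y)=-\int_y^{+\infty}e^{-t}\,dt$ and $h(y)=-\int_y^{+\infty}e^{-t}M(t)\,dt$ for all $y\in(0,+\infty)$. Then $\frac{h}{\varphi}$ and $\log\frac{h}{\varphi}$ both belong to $\mathcal{D}^2(0,+\infty)$, and moreover $$\Bigl(\frac{h}{\varphi}\Bigr)'<0,\qquad \Bigl(\log\frac{h}{\varphi}\Bigr)''>0\qquad\text{on }(0,+\infty).$$
   Context: For a non-empty open interval $I\subset\mathbb{R}$ and $n\ge 1$, $\mathcal{D}^n(I)$ denotes the class of all real-valued functions having a finite $n$-th derivative everywhere in $I$ (no continuity of the $n$-th derivative is required). $H^p$ is the Hardy space of the upper half-plane: the holomorphic functions $f$ on $\{z\in\mathbb{C}:\operatorname{Im}z>0\}$ with $\sup_{y>0}\int_{-\infty}^{+\infty}|f(x+iy)|^p\,dx<+\infty$. A prime denotes differentiation. *)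

(* Defs.v *)
From mathcomp Require Import all_boot all_order all_algebra.
From mathcomp Require Import complex.
From mathcomp Require Import all_classical all_reals all_analysis.
Import Order.TTheory GRing.Theory Num.Theory numFieldNormedType.Exports.

Set Implicit Arguments.
Unset Strict Implicit.
Unset Printing Implicit Defensive.

Local Open Scope ring_scope.
Local Open Scope complex_scope.
Local Open Scope classical_set_scope.

(* [D_class n I] is the class of functions with a finite n-th derivative at
   every point of the open interval I.  For the n-th derivative to be defined
   on I, all the earlier ones must be; the values off I are irrelevant. *)
Definition D_class (R : realType) (n : nat) (I : set R) : set (R -> R) :=
  [set g | forall k, (k < n)%N -> forall x, I x -> derivable g^`(k) x 1].

Definition upper_half_plane (R : realType) : set R[i] :=
  [set z | 0 < complex.Im z].
Arguments upper_half_plane : clear implicits.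

(* R[i]^o is R[i] as a normed space over itself, so that [derivable]
   takes limits over complex increments: this is complex differentiability at
   every point of the open set U. *)
Definition holomorphic_on (R : realType) (U : set R[i]) (f : R[i] -> R[i]) :=
  forall z : R[i], U z -> derivable (f : R[i]^o -> R[i]^o) z 1.

(* Functions on the half-plane are represented by total functions whose values
   off the half-plane are irrelevant.  [Normc.normc] is the R-valued modulus. *)
Definition hardy_space (R : realType) (p : R) : set (R[i] -> R[i]) :=
  [set f | holomorphic_on (upper_half_plane R) f /\
    (ereal_sup
       [set (\int[@lebesgue_measure R]_x
               ((Normc.normc (f (x +i* y)) `^ p)%:E))%E
       | y in [set y : R | (0 < y)%R]] < +oo)%E].

(* Main.v *)
Require Import Defs.
From mathcomp Require Import all_boot all_order all_algebra.
From mathcomp Require Import complex.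
From mathcomp Require Import all_classical all_reals all_analysis.
From mathcomp Require Import measurable_realfun.
From mathcomp Require Import ring lra.
Import Order.TTheory GRing.Theory Num.Theory numFieldNormedType.Exports.

Local Open Scope ring_scope.
Local Open Scope complex_scope.
Local Open Scope classical_set_scope.

Set Implicit Arguments.
Unset Strict Implicit.
Unset Printing Implicit Defensive.

(** Write [q = h / phi], so that [q y = e^y * \int_(t > y) e^(-t) M t].  Then
[q' = q - M] and [(ln q)'' = (q * (M - M') - M^2) / q^2], and the two claims are
[q < M] and [q * (M - M') > M^2].  Since [q y] averages [M] over [t > y] against
a probability density, the first holds as soon as [M] is strictly decreasing.
The second follows once every function [K_c y = e^(c y) * M y], with [c] real, is
strictly convex ([strict_convex_exp_mean]): for [c = - M' y / M y] the point [y]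
is critical for [K_c], hence [M t > M y * e^(- c (t - y))] for [t > y], and
integrating gives [q y > M y / (1 + c) = (M y)^2 / (M y - M' y)]
([exp_tail_gt]).  The case [c = 0] makes [M] strictly convex; being bounded, it
is then strictly decreasing ([exp_convex_decreasing]).

The convexity comes from subharmonicity. [K_c] is the mean over horizontal lines
of [|g|^p] for the holomorphic function [g z = f z * e^(- i (c / p) z)]
([line_mean_twist]), and the value of [|g|^p] at a point is at most its mean
over any circle about the point ([nc_mean_pow]). Integrating over all horizontal
translates of a circle of radius [r] gives, by Tonelli's theorem and translation
invariance, [2 pi * K_c y <= \int_(0 <= t <= 2 pi) K_c (y + r sin t)]
([submean]). A continuous function of one real variable with this property is
convex: its difference with a chord cannot have a positive interior maximum
([convex_of_submean]); if the inequality is strict, so is the convexity.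
Equality would make [g] constant on every circle of radius [r] centred on the
line ([nc_mean_pow_eq]), thus constant on the line, where [|g|^p] is integrable:
so it is only possible where [M] vanishes ([strict_submean]). And [M] has no
zero, because the weak convexity of all the [K_c] would spread one zero to the
whole half-line ([positive_of_exp_convex]).

The second derivatives involve [M'], so [M] has to be differentiated
under the integral sign ([derivable_mean]), which rests on
[|d/dy |f|^p| <= p * (|f|^p + |f'|^p)] ([vertical_derivative_pow]).  Circle means
of [f] give Cauchy's estimate for [f'], so the line means of [|f'|^p] are locally
bounded; integrating the inequality vertically dominates [|f|^p] on a strip by an
integrable function ([line_pow_dominated]), and Cauchy's estimate once more
dominates [|f'|^p] ([derivative_dominated]).

The complex analysis reduces to two mean value formulas, for [f] and for [f'].
With [w = s + i t], the function [w |-> f (z + e^w)] is [2 i pi]-periodic and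
holomorphic on a left half-plane; Goursat's theorem on the rectangles
[[s1, s2] x [0, 2 pi]], whose horizontal sides cancel, says that its mean over
[0 <= t <= 2 pi] does not depend on [s] ([periodic_circle]), and letting [s] tend
to [-oo] shrinks the circle to its centre ([periodic_mean]). *)

(** * Epsilon-delta forms of limits in one real variable *)

Section RealEpsilon.
Context {R : realType}.

Lemma eps_continuous (u : R -> R) (x : R) :
  (forall e : R, 0 < e -> exists2 del : R, 0 < del &
    forall h : R, `|h| <= del -> `|u (x + h) - u x| <= e) ->
  {for x, continuous u}.
Proof.
move=> H; apply/cvgrPdist_le => e e0; have [del del0 {}H] := H e e0.
near=> y; have -> : y = x + (y - x) by ring.
rewrite distrC; apply: H; rewrite distrC.
by near: y; apply/nbhs_ballP; exists del => // y; rewrite /ball/= => /ltW.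
Unshelve. all: by end_near. Qed.

Lemma is_derive_eps (f : R -> R) (x l : R) : is_derive x (1 : R) f l ->
  forall e : R, 0 < e -> exists2 del : R, 0 < del &
  forall h : R, `|h| <= del -> `|f (x + h) - f x - l * h| <= e * `|h|.
Proof.
move=> [df dl] e e0.
have {df} : h^-1 *: (f (h *: 1 + x) - f x) @[h --> 0^'] --> l by rewrite -dl; exact: df.
move/cvgrPdist_le => /(_ _ e0)[del /= del0 H].
exists (del / 2); first by rewrite divr_gt0.
move=> h hd; have [->|h0] := eqVneq h 0.
  by rewrite addr0 subrr mulr0 subr0 normr0 mulr0.
have {}H : `|l - h^-1 *: (f (h *: 1 + x) - f x)| <= e.
  apply: H => //; rewrite /= sub0r normrN; apply: le_lt_trans hd _.
  by rewrite ltr_pdivrMr// mulr_natr mulr2n ltrDl.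
have -> : f (x + h) - f x - l * h = - (l - h^-1 *: (f (h *: 1 + x) - f x)) * h.
  by rewrite /GRing.scale/= mulr1 (addrC h); field.
by rewrite normrM normrN ler_wpM2r.
Qed.

Lemma eps_is_derive (u : R -> R) (x l : R) :
  (forall e : R, 0 < e -> exists2 del : R, 0 < del &
    forall h : R, `|h| <= del -> `|u (x + h) - u x - l * h| <= e * `|h|) ->
  is_derive x (1 : R) u l.
Proof.
move=> H; have cv : h^-1 *: (u (h *: 1 + x) - u x) @[h --> 0^'] --> l.
  apply/cvgrPdist_le => e e0; have [del del0 {}H] := H e e0.
  near=> h.
  have h0 : h != 0 by near: h; exact: nbhs_dnbhs_neq.
  have hd : `|h| <= del by near: h; apply: dnbhs0_le.
  have -> : l - h^-1 *: (u (h *: 1 + x) - u x) = - (u (x + h) - u x - l * h) / h.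
    by rewrite /GRing.scale/= mulr1 (addrC h); field.
  rewrite normrM normrN normfV ler_pdivrMr ?normr_gt0//; exact: H.
split; first by apply/cvg_ex; exists l.
exact/cvg_lim.
Unshelve. all: by end_near. Qed.

End RealEpsilon.

(** * Complex differentiability *)

Section ComplexDiff.
Context {R : realType}.
Implicit Types (z w d : R[i]) (f g : R[i] -> R[i]).
Local Notation nc := (@Normc.normc R).

Lemma normc_norm z : (nc z)%:C = `|z| :> R[i].
Proof. by case: z. Qed.

Lemma nc_ge0 z : 0 <= nc z.
Proof. by rewrite -lecR normc_norm normr_ge0. Qed.

Lemma nc0 : nc 0 = 0. Proof. exact: Normc.normc0. Qed.

Lemma ncM z w : nc (z * w) = nc z * nc w.
Proof. exact: Normc.normcM. Qed.

Lemma ncD z w : nc (z + w) <= nc z + nc w.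
Proof. by rewrite -lecR rmorphD/= !normc_norm ler_normD. Qed.

Lemma ncN z : nc (- z) = nc z.
Proof. by case: z => a b /=; rewrite !sqrrN. Qed.

Lemma ncB z w : nc (z - w) <= nc z + nc w.
Proof. by rewrite -(ncN w) ncD. Qed.

Lemma nc_sqr z : nc z ^+ 2 = complex.Re z ^+ 2 + complex.Im z ^+ 2.
Proof. by case: z => a b /=; rewrite sqr_sqrtr// addr_ge0 ?sqr_ge0. Qed.

Lemma nc_real (a : R) : nc a%:C = `|a|.
Proof. by rewrite /= expr0n/= addr0 sqrtr_sqr. Qed.

Lemma nc_imag (a : R) : nc (0 +i* a) = `|a|.
Proof. by rewrite /= expr0n/= add0r sqrtr_sqr. Qed.

Lemma Re_le_nc z : `|complex.Re z| <= nc z.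
Proof. by rewrite -ler_sqr ?nnegrE ?nc_ge0// nc_sqr real_normK ?num_real// lerDl sqr_ge0. Qed.

Lemma Im_le_nc z : `|complex.Im z| <= nc z.
Proof. by rewrite -ler_sqr ?nnegrE ?nc_ge0// nc_sqr real_normK ?num_real// lerDr sqr_ge0. Qed.

Lemma nc_le_ReIm z : nc z <= `|complex.Re z| + `|complex.Im z|.
Proof.
case: z => a b; have -> : a +i* b = a%:C + (0 +i* b) by rewrite /real_complex_def; simpc.
by apply: le_trans (ncD _ _) _; rewrite nc_real nc_imag /=; simpc.
Qed.

Lemma ReB z w : complex.Re (z - w) = complex.Re z - complex.Re w.
Proof. by case: z; case: w. Qed.

Lemma ImB z w : complex.Im (z - w) = complex.Im z - complex.Im w.
Proof. by case: z; case: w. Qed.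

Lemma line_real (s t : R) : s +i* t = (0 +i* t) + s%:C * 1.
Proof. by rewrite mulr1 /real_complex_def; simpc. Qed.

Lemma line_imag (s t : R) : s +i* t = s%:C + t%:C * 'i.
Proof. by rewrite /real_complex_def; simpc. Qed.

Lemma nc1 : nc 1 = 1. Proof. exact: Normc.normc1. Qed.

Lemma nci : nc 'i = 1. Proof. by rewrite nc_imag normr1. Qed.

(** Complex differentiability in epsilon-delta form with the real-valued modulus:
restricting it to horizontal or vertical increments gives estimates over the
reals at once. *)
Definition cdiff f z d := forall e : R, 0 < e -> exists2 del : R, 0 < del &
  forall w, nc w <= del -> nc (f (z + w) - f z - d * w) <= e * nc w.

Lemma derivable_cdiff f z :
  derivable (f : R[i]^o -> R[i]^o) z 1 -> exists d, cdiff f z d.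
Proof.
move=> /cvg_ex[/= d fd]; exists d => e e0.
have e0' : 0 < e%:C by rewrite ltcR.
move/cvgrPdist_le : fd => /(_ _ e0')[del /= del0 H].
have del_re : del = (complex.Re del)%:C.
  by rewrite RRe_real// gtr0_real.
have del0' : 0 < complex.Re del by rewrite -ltcR -del_re.
exists (complex.Re del / 2); first by rewrite divr_gt0.
move=> w wdel; have [->|w0] := eqVneq w 0.
  by rewrite addr0 subrr mulr0 subr0 nc0 mulr0.
have := H w; rewrite /ball /= sub0r normrN -normc_norm del_re ltcR => /(_ _ w0) H'.
have {}H' : `|d - w^-1 *: (f (w *: 1 + z) - f z)| <= e%:C.
  by apply: H'; apply: le_lt_trans wdel _; rewrite ltr_pdivrMr// mulr_natr mulr2n ltrDl.
rewrite -lecR rmorphM/= !normc_norm.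
have -> : f (z + w) - f z - d * w = - (d - w^-1 *: (f (w *: 1 + z) - f z)) * w.
  rewrite /GRing.scale/= mulr1 addrC opprB mulrBl mulrAC mulVf// mul1r addrC.
  by rewrite (addrC w).
by rewrite normrM normrN ler_wpM2r.
Qed.

Lemma cdiff_cont f z d : cdiff f z d -> forall e : R, 0 < e ->
  exists2 del : R, 0 < del & forall w, nc w <= del -> nc (f (z + w) - f z) <= e.
Proof.
move=> fd e e0; have [del del0 H] := fd 1 ltr01.
have k0 : 0 < 1 + nc d by rewrite ltr_wpDr ?nc_ge0.
exists (Num.min del (e / (1 + nc d))); first by rewrite lt_min del0 divr_gt0.
move=> w; rewrite le_min => /andP[w1 w2].
have -> : f (z + w) - f z = (f (z + w) - f z - d * w) + d * w by ring.
apply: le_trans (ncD _ _) _; apply: le_trans (lerD (H w w1) (lexx _)) _.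
by rewrite ncM -mulrDl mulrC -ler_pdivlMr.
Qed.

Lemma cdiff_cst c z : cdiff (fun=> c) z 0.
Proof.
by move=> e e0; exists 1 => // w _; rewrite mul0r subrr subr0 nc0 mulr_ge0 ?nc_ge0// ltW.
Qed.

Lemma cdiff_lin a z : cdiff (fun z => a * z) z a.
Proof.
move=> e e0; exists 1 => // w _.
have -> : a * (z + w) - a * z - a * w = 0 by ring.
by rewrite nc0 mulr_ge0 ?nc_ge0// ltW.
Qed.

Lemma cdiff_add f g z d d' : cdiff f z d -> cdiff g z d' ->
  cdiff (fun z => f z + g z) z (d + d').
Proof.
move=> fd gd e e0; have e20 : 0 < e / 2 by rewrite divr_gt0.
have [r1 r10 H1] := fd _ e20; have [r2 r20 H2] := gd _ e20.
exists (Num.min r1 r2); first by rewrite lt_min r10.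
move=> w; rewrite le_min => /andP[w1 w2].
have -> : f (z + w) + g (z + w) - (f z + g z) - (d + d') * w =
  (f (z + w) - f z - d * w) + (g (z + w) - g z - d' * w) by ring.
apply: le_trans (ncD _ _) _; apply: le_trans (lerD (H1 w w1) (H2 w w2)) _.
by rewrite -mulrDl -splitr.
Qed.

Lemma cdiff_comp f g z d d' : cdiff f z d -> cdiff g (f z) d' ->
  cdiff (fun z => g (f z)) z (d' * d).
Proof.
move=> fd gd e e0.
have n0 : 0 < nc d + 1 by rewrite ltr_wpDl ?nc_ge0.
have n0' : 0 < nc d' + 1 by rewrite ltr_wpDl ?nc_ge0.
have e1 : 0 < e / 2 / (nc d + 1) by rewrite !divr_gt0.
have e2 : 0 < Num.min 1 (e / 2 / (nc d' + 1)) by rewrite lt_min ltr01 !divr_gt0.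
have [r2 r20 H2] := gd _ e1; have [r1 r10 H1] := fd _ e2.
exists (Num.min r1 (r2 / (nc d + 1))); first by rewrite lt_min r10 divr_gt0.
move=> w; rewrite le_min => /andP[w1 w2]; have w0 := nc_ge0 w.
set k := f (z + w) - f z.
have k1 := H1 w w1; rewrite -/k in k1.
have kw : nc k <= (nc d + 1) * nc w.
  have -> : k = (k - d * w) + d * w by ring.
  apply: le_trans (ncD _ _) _; rewrite ncM mulrDl mul1r addrC lerD2l.
  by apply: le_trans k1 _; rewrite -[leRHS]mul1r ler_wpM2r// ge_min lexx.
have kr : nc k <= r2 by apply: le_trans kw _; rewrite mulrC -ler_pdivlMr.
have k2 := H2 k kr.
have fk : f z + k = f (z + w) by rewrite /k; ring.
rewrite fk in k2.
have -> : g (f (z + w)) - g (f z) - d' * d * w =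
  (g (f (z + w)) - g (f z) - d' * k) + d' * (k - d * w) by ring.
apply: le_trans (ncD _ _) _; rewrite ncM.
have a1 : nc (g (f (z + w)) - g (f z) - d' * k) <= e / 2 * nc w.
  apply: le_trans k2 _; apply: le_trans (ler_wpM2l (ltW e1) kw) _.
  by rewrite mulrA divfK// gt_eqF.
have a2 : nc d' * nc (k - d * w) <= e / 2 * nc w.
  apply: le_trans (ler_wpM2l (nc_ge0 _) k1) _.
  rewrite mulrA ler_wpM2r//.
  apply: (@le_trans _ _ (nc d' * (e / 2 / (nc d' + 1)))).
    by rewrite ler_wpM2l ?nc_ge0// ge_min lexx orbT.
  have e2' : 0 < e / 2 by rewrite divr_gt0.
  rewrite mulrCA -[leRHS]mulr1 ler_pM2l// ler_pdivrMr// mul1r; lra.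
apply: le_trans (lerD a1 a2) _; rewrite -mulrDl -splitr; exact: lexx.
Qed.

Lemma cdiff_sqr z : cdiff (fun z => z * z) z (z + z).
Proof.
move=> e e0; exists e => // w we.
have -> : (z + w) * (z + w) - z * z - (z + z) * w = w * w by ring.
by rewrite ncM ler_wpM2r ?nc_ge0.
Qed.

Lemma cdiff_eq f z d d' : d = d' -> cdiff f z d -> cdiff f z d'.
Proof. by move=> ->. Qed.

(** As [f * g] is half of [(f + g)^2 - (f^2 + g^2)], the product rule follows
from the chain rule for the square. *)
Lemma cdiff_mul f g z d d' : cdiff f z d -> cdiff g z d' ->
  cdiff (fun z => f z * g z) z (d * g z + f z * d').
Proof.
move=> fd gd.
have two : (2 : R[i]) != 0 by rewrite pnatr_eq0.
have H := cdiff_add (cdiff_comp (cdiff_comp (cdiff_add fd gd) (cdiff_sqr _)) (cdiff_lin (2^-1) _))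
  (cdiff_comp (cdiff_add (cdiff_comp fd (cdiff_sqr _)) (cdiff_comp gd (cdiff_sqr _)))
  (cdiff_lin (- 2^-1) _)).
have -> : (fun z => f z * g z) = fun z => 2^-1 * ((f z + g z) * (f z + g z)) +
  - 2^-1 * (f z * f z + g z * g z) by apply/funext => x; field.
by apply: cdiff_eq H => /=; field.
Qed.

End ComplexDiff.

Section ComplexContinuity.
Context {R : realType}.
Implicit Types (z w d : R[i]) (f g : R[i] -> R[i]) (h k : R -> R[i]).
Local Notation nc := (@Normc.normc R).

Definition ccont h t := forall e : R, 0 < e -> exists2 del : R, 0 < del &
  forall x : R, `|x| <= del -> nc (h (t + x) - h t) <= e.

Lemma ccont_Re h t : ccont h t -> {for t, continuous (fun t => complex.Re (h t))}.
Proof.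
move=> H; apply: eps_continuous => e e0; have [del del0 {}H] := H e e0.
by exists del => // x xd; apply: le_trans (H x xd); rewrite -ReB Re_le_nc.
Qed.

Lemma ccont_Im h t : ccont h t -> {for t, continuous (fun t => complex.Im (h t))}.
Proof.
move=> H; apply: eps_continuous => e e0; have [del del0 {}H] := H e e0.
by exists del => // x xd; apply: le_trans (H x xd); rewrite -ImB Im_le_nc.
Qed.

Lemma nc_dist z w : `|nc z - nc w| <= nc (z - w).
Proof.
have h1 := ncD (z - w) w; have h2 := ncD (w - z) z.
rewrite !subrK in h1 h2; rewrite -[w - z]opprB ncN in h2.
by rewrite ler_norml; apply/andP; split; lra.
Qed.

Lemma ccont_nc h t : ccont h t -> {for t, continuous (fun t => nc (h t))}.
Proof.
move=> H; apply: eps_continuous => e e0; have [del del0 {}H] := H e e0.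
by exists del => // x xd; apply: le_trans (H x xd); exact: nc_dist.
Qed.

Lemma ccont_cst z t : ccont (fun=> z) t.
Proof. by move=> e e0; exists 1 => // x _; rewrite subrr nc0 ltW. Qed.

Lemma ccontB h k t : ccont h t -> ccont k t -> ccont (fun t => h t - k t) t.
Proof.
move=> hc kc e e0; have e20 : 0 < e / 2 by rewrite divr_gt0.
have [r1 r10 H1] := hc _ e20; have [r2 r20 H2] := kc _ e20.
exists (Num.min r1 r2); first by rewrite lt_min r10.
move=> x; rewrite le_min => /andP[/H1 x1 /H2 x2].
have -> : h (t + x) - k (t + x) - (h t - k t) =
  (h (t + x) - h t) - (k (t + x) - k t) by ring.
by apply: le_trans (ncB _ _) _; lra.
Qed.

Lemma ccontM h k t : ccont h t -> ccont k t -> ccont (fun t => h t * k t) t.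
Proof.
move=> hc kc e e0.
have n1 : 0 < nc (h t) + 1 by rewrite ltr_wpDl ?nc_ge0.
have n2 : 0 < nc (k t) + 1 by rewrite ltr_wpDl ?nc_ge0.
have e20 : 0 < e / 2 by rewrite divr_gt0.
have [r1 r10 H1] := hc _ (divr_gt0 e20 n2).
have e30 : 0 < Num.min 1 (e / 2 / (nc (h t) + 1)) by rewrite lt_min ltr01 divr_gt0.
have [r2 r20 H2] := kc _ e30.
exists (Num.min r1 r2); first by rewrite lt_min r10.
move=> x; rewrite le_min => /andP[/H1 x1 /H2]; rewrite le_min => /andP[x2 x3].
have -> : h (t + x) * k (t + x) - h t * k t =
  (h (t + x) - h t) * k (t + x) + h t * (k (t + x) - k t) by ring.
have kx : nc (k (t + x)) <= nc (k t) + 1.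
  by have := nc_dist (k (t + x)) (k t); rewrite ler_norml; lra.
apply: le_trans (ncD _ _) _; rewrite !ncM [leRHS]splitr; apply: lerD.
  apply: (@le_trans _ _ (e / 2 / (nc (k t) + 1) * (nc (k t) + 1))).
    by apply: ler_pM; rewrite ?nc_ge0.
  by rewrite divfK// gt_eqF.
apply: (@le_trans _ _ ((nc (h t) + 1) * (e / 2 / (nc (h t) + 1)))).
  by apply: ler_pM; rewrite ?nc_ge0// lerDl.
by rewrite mulrC divfK// gt_eqF.
Qed.

Lemma ccont_line g z a (t : R) d : nc a <= 1 ->
  cdiff g (z + t%:C * a) d -> ccont (fun t : R => g (z + t%:C * a)) t.
Proof.
move=> a1 gd e e0; have [del del0 H] := cdiff_cont gd e0; exists del => // h hd.
have -> : z + (t + h)%:C * a = (z + t%:C * a) + h%:C * a by rewrite rmorphD/=; ring.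
by apply: H; rewrite ncM nc_real; apply: le_trans hd; rewrite ler_piMr.
Qed.

Lemma ccont_vert g (s t : R) d : cdiff g (s +i* t) d ->
  ccont (fun t : R => g (s +i* t)) t.
Proof.
rewrite line_imag => /ccont_line; rewrite nci => /(_ (lexx _)).
by under [X in ccont X]eq_fun do rewrite -line_imag.
Qed.

Lemma ccont_horiz g (s t : R) d : cdiff g (s +i* t) d ->
  ccont (fun s : R => g (s +i* t)) s.
Proof.
rewrite line_real => /ccont_line; rewrite nc1 => /(_ (lexx _)).
by under [X in ccont X]eq_fun do rewrite -line_real.
Qed.

(** Away from zero the power is differentiable; at a zero of [u] the bound
[u <= e^(1/p)] suffices. *)
Lemma continuous_powR (u : R -> R) (p t : R) : 0 < p -> (forall s, 0 <= u s) ->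
  {for t, continuous u} -> {for t, continuous (fun t => u t `^ p)}.
Proof.
move=> p0 u0 cu; have := u0 t; rewrite le_eqVlt => /predU1P[ut0|ut0].
  apply/cvgrPdist_le => e e0; rewrite -ut0 powR0 ?gt_eqF//.
  have e1 : 0 < e `^ p^-1 by rewrite powR_gt0.
  have /cvgrPdist_le/(_ _ e1) := cu; apply: filterS => s.
  rewrite -ut0 !sub0r !normrN !ger0_norm ?powR_ge0// => us.
  rewrite -[leRHS]powRr1 ?(ltW e0)// -[X in _ <= _ `^ X](mulVf (lt0r_neq0 p0)) powRrM.
  by apply: ge0_ler_powR; rewrite ?nnegrE ?powR_ge0 ?(ltW p0).
apply: (@continuous_comp _ _ _ u (fun x => x `^ p)); first exact: cu.
apply/differentiable_continuous/derivable1_diffP.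
by apply: derivable_powR; rewrite in_itv/= andbT.
Qed.

End ComplexContinuity.

Section ComplexExp.
Context {R : realType}.
Implicit Types (z w d : R[i]) (f g : R[i] -> R[i]).
Local Notation nc := (@Normc.normc R).

Definition cexp z : R[i] :=
  (expR (complex.Re z) * cos (complex.Im z)) +i* (expR (complex.Re z) * sin (complex.Im z)).

Lemma cexpD z w : cexp (z + w) = cexp z * cexp w.
Proof.
case: z w => [a b] [c d]; rewrite /cexp /= expRD sinD cosD; simpc.
by congr (_ +i* _); ring.
Qed.

Lemma cexp0 : cexp 0 = 1.
Proof. by rewrite /cexp /= expR0 cos0 sin0 !mul1r. Qed.

Lemma nc_cexp z : nc (cexp z) = expR (complex.Re z).
Proof.
by rewrite /cexp /= !exprMn -mulrDr cos2Dsin2 mulr1 sqrtr_sqr ger0_norm// expR_ge0.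
Qed.

(** The error [e^w - 1 - w] is expanded through the first-order errors of the real
exponential, cosine and sine, using [expR a * cos b - 1 - a =
(expR a - 1 - a) + expR a * (cos b - 1)] and its analogue for the sine.  If those
errors are at most [e' * |w|], with [|w| <= e' <= 1], the terms add up to at most
[9 * e' * |w|]. *)
Lemma cexp_near0 (e : R) : 0 < e -> exists2 del : R, 0 < del &
  forall w, nc w <= del -> nc (cexp w - 1 - w) <= e * nc w.
Proof.
move=> e0; pose e' := Num.min 1 (e / 16).
have e'0 : 0 < e' by rewrite lt_min ltr01 divr_gt0.
have e'1 : e' <= 1 by rewrite ge_min lexx.
have e'e : e' <= e / 16 by rewrite ge_min lexx orbT.
clearbody e'.
have [r1 r10 H1] := is_derive_eps (is_derive_expR 0) e'0.
have [r2 r20 H2] := is_derive_eps (is_derive_cos 0) e'0.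
have [r3 r30 H3] := is_derive_eps (is_derive_sin 0) e'0.
exists (Num.min r1 (Num.min r2 (Num.min r3 e'))).
  by rewrite !lt_min r10 r20 r30 e'0.
case=> a b; set w := a +i* b; rewrite !le_min => /and4P[w1 w2 w3 w4].
have aw : `|a| <= nc w := Re_le_nc w.
have bw : `|b| <= nc w := Im_le_nc w.
have := H1 a (le_trans aw w1); have := H2 b (le_trans bw w2).
have := H3 b (le_trans bw w3).
rewrite !add0r expR0 cos0 sin0 oppr0 !mul0r !mul1r !subr0 ?oppr0 ?addr0.
have [W WE] : exists W : R, W = nc w by exists (nc w).
have Wge0 : 0 <= W by rewrite WE nc_ge0.
rewrite -WE in aw bw w1 w2 w3 w4 *.
move=> k3 k2 k1.
have l3 : `|sin b - b| <= e' * W by apply: le_trans k3 _; rewrite ler_pM2l.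
have l2 : `|cos b - 1| <= e' * W by apply: le_trans k2 _; rewrite ler_pM2l.
have l1 : `|expR a - 1 - a| <= e' * W by apply: le_trans k1 _; rewrite ler_pM2l.
have W1 : W <= 1 by lra.
have eW : e' * W <= 1 by nra.
have Ea1 : `|expR a - 1| <= 2 * W.
  have -> : expR a - 1 = (expR a - 1 - a) + a by ring.
  by apply: le_trans (ler_normD _ _) _; nra.
have Ea : `|expR a| <= 3.
  have -> : expR a = (expR a - 1) + 1 by ring.
  by apply: le_trans (ler_normD _ _) _; rewrite normr1; lra.
apply: le_trans (nc_le_ReIm _) _; rewrite /cexp /=.
have -> : expR a * cos b - 1 - a = (expR a - 1 - a) + expR a * (cos b - 1) by ring.
have -> : expR a * sin b - 0 - b = expR a * (sin b - b) + (expR a - 1) * b by ring.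
have t1 : `|expR a * (cos b - 1)| <= 3 * (e' * W) by rewrite normrM ler_pM.
have t2 : `|expR a * (sin b - b)| <= 3 * (e' * W) by rewrite normrM ler_pM.
have t3 : `|(expR a - 1) * b| <= 2 * W * e'.
  by rewrite normrM ler_pM//; lra.
have q1 := ler_normD (expR a - 1 - a) (expR a * (cos b - 1)).
have q2 := ler_normD (expR a * (sin b - b)) ((expR a - 1) * b).
have : 16 * (e' * W) <= e * W by rewrite mulrA ler_wpM2r//; lra.
nra.
Qed.

Lemma cdiff_cexp z : cdiff cexp z (cexp z).
Proof.
move=> e e0; have k0 : 0 < nc (cexp z) by rewrite nc_cexp expR_gt0.
have [del del0 H] := cexp_near0 (divr_gt0 e0 k0).
exists del => // w wd; rewrite cexpD.
have -> : cexp z * cexp w - cexp z - cexp z * w = cexp z * (cexp w - 1 - w) by ring.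
rewrite ncM mulrC -ler_pdivlMr//; apply: le_trans (H w wd) _.
by rewrite mulrAC.
Qed.

Lemma cexp_period z : cexp (z + (0 +i* (2 * pi))) = cexp z.
Proof.
rewrite cexpD; suff -> : cexp (0 +i* (2 * pi)) = 1 by rewrite mulr1.
by rewrite /cexp /= expR0 !mul1r mulr_natl cos2pi sin2pi.
Qed.

End ComplexExp.

(** * Goursat's theorem on rectangles *)

Section Goursat.
Context {R : realType}.
Implicit Types (F P Q : R -> R -> R) (a b c d s t : R).

(** For [F] a primitive in its first (second) variable, this is the sum of the
integrals over the two horizontal (vertical) sides of the rectangle
[[a, b] x [c, d]], taken with opposite signs. *)
Definition rect_diff F a b c d := F b d - F b c - F a d + F a c.

(** Total differentiability at [(s, t)], with partial derivatives [p] and [k]. *)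
Definition real_diff P s t p k := forall e : R, 0 < e -> exists2 del : R, 0 < del &
  forall s' t', `|s' - s| <= del -> `|t' - t| <= del ->
  `|P s' t' - P s t - p * (s' - s) - k * (t' - t)| <= e * (`|s' - s| + `|t' - t|).

(** [rect_diff F] is additive under cutting a rectangle into four quarters, so one
of these carries at least a quarter of its absolute value. *)
Lemma rect_diff_quarter F a b c d : a <= b -> c <= d ->
  exists q : R * R * R * R, let: (a', b', c', d') := q in
  [/\ a <= a' /\ b' <= b, c <= c' /\ d' <= d,
      b' - a' = (b - a) / 2, d' - c' = (d - c) / 2 &
      `|rect_diff F a b c d| <= 4 * `|rect_diff F a' b' c' d'|].
Proof.
move=> ab cd; pose m := (a + b) / 2; pose n := (c + d) / 2.
have split4 : rect_diff F a b c d = rect_diff F a m c n + rect_diff F m b c n +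
    rect_diff F a m n d + rect_diff F m b n d by rewrite /rect_diff; ring.
have [am mb cn nd] : [/\ a <= m, m <= b, c <= n & n <= d].
  by rewrite /m /n; split; lra.
have [e1 e2 e3 e4] : [/\ m - a = (b - a) / 2, b - m = (b - a) / 2,
    n - c = (d - c) / 2 & d - n = (d - c) / 2] by rewrite /m /n; split; field.
have small (x y z w : R) : `|x + y + z + w| <= `|x| + `|y| + `|z| + `|w|.
  have := ler_normD (x + y + z) w; have := ler_normD (x + y) z.
  have := ler_normD x y; lra.
set T := `|rect_diff F a b c d|.
have [h1|h1] := lerP T (4 * `|rect_diff F a m c n|); first by exists (a, m, c, n); split.
have [h2|h2] := lerP T (4 * `|rect_diff F m b c n|); first by exists (m, b, c, n); split.
have [h3|h3] := lerP T (4 * `|rect_diff F a m n d|); first by exists (a, m, n, d); split.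
have [h4|h4] := lerP T (4 * `|rect_diff F m b n d|); first by exists (m, b, n, d); split.
have := small (rect_diff F a m c n) (rect_diff F m b c n) (rect_diff F a m n d)
  (rect_diff F m b n d).
rewrite -split4 -/T => h5; lra.
Qed.

(** Iterated quartering; the nested rectangles shrink to a point [(s, t)] at which
differentiability can be exploited. *)
Lemma rect_diff_nested F a b c d : a <= b -> c <= d ->
  exists s t, (a <= s <= b /\ c <= t <= d) /\ forall n, exists a' b' c' d',
  [/\ a <= a' <= s, s <= b' <= b, c <= c' <= t, t <= d' <= d &
  [/\ b' - a' = (b - a) / 2 ^+ n, d' - c' = (d - c) / 2 ^+ n &
      `|rect_diff F a b c d| <= 4 ^+ n * `|rect_diff F a' b' c' d'|]].
Proof.
move=> ab cd.
have H (q : R * R * R * R) : exists q' : R * R * R * R,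
    let: (a0, b0, c0, d0) := q in let: (a', b', c', d') := q' in
    a0 <= b0 -> c0 <= d0 ->
    [/\ a0 <= a' /\ b' <= b0, c0 <= c' /\ d' <= d0,
      b' - a' = (b0 - a0) / 2, d' - c' = (d0 - c0) / 2 &
      `|rect_diff F a0 b0 c0 d0| <= 4 * `|rect_diff F a' b' c' d'|].
  move: q => [[[a0 b0] c0] d0].
  have [ab0|ab0] := pselect (a0 <= b0); last by exists (0, 0, 0, 0).
  have [cd0|cd0] := pselect (c0 <= d0); last by exists (0, 0, 0, 0).
  have [q' hq'] := rect_diff_quarter F ab0 cd0; exists q'.
  by move: q' hq' => [[[a' b'] c'] d'].
have [step hstep] := choice H.
pose u n := iter n step (a, b, c, d).
pose A n := (u n).1.1.1; pose B n := (u n).1.1.2.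
pose C n := (u n).1.2; pose D n := (u n).2.
have key n : [/\ a <= A n <= B n, B n <= b, c <= C n <= D n, D n <= d &
    [/\ B n - A n = (b - a) / 2 ^+ n, D n - C n = (d - c) / 2 ^+ n,
      `|rect_diff F a b c d| <= 4 ^+ n * `|rect_diff F (A n) (B n) (C n) (D n)| &
    [/\ A n <= A n.+1, B n.+1 <= B n, C n <= C n.+1 & D n.+1 <= D n]]].
  elim: n => [|n [/andP[aA AB] Bb /andP[cC CD] Dd [eB eD le4 _]]].
    have := hstep (u 0); rewrite /A /B /C /D /=.
    case: (step (a, b, c, d)) => [[[a' b'] c'] d'] /= /(_ ab cd)[[aa' bb'] [cc' dd'] _ _ _].
    by rewrite !lexx ab cd !expr0 !divr1 mul1r; split.
  have ustep : u n.+1 = step (u n) by [].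
  have := hstep (u n); rewrite -ustep; move: (hstep (u n.+1)).
  rewrite -[step (u n.+1)]/(u n.+2).
  rewrite -/(A _) /A /B /C /D in aA AB Bb cC CD Dd eB eD le4 *.
  move: aA AB Bb cC CD Dd eB eD le4.
  case: (u n) => [[[a0 b0] c0] d0]; case: (u n.+1) => [[[a1 b1] c1] d1].
  case: (u n.+2) => [[[a2 b2] c2] d2] /=.
  move=> aA AB Bb cC CD Dd eB eD le4 st2 /(_ AB CD)[[aa bb] [cc dd] e1 e2 l4].
  have ab1 : a1 <= b1 by lra.
  have cd1 : c1 <= d1 by lra.
  have [[aa2 bb2] [cc2 dd2] _ _ _] := st2 ab1 cd1.
  rewrite !exprS !invfM; split; [lra|lra|lra|lra|split] => //.
  - by rewrite e1 eB; ring.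
  - by rewrite e2 eD; ring.
  - apply: le_trans le4 _.
    rewrite [4 * _]mulrC -mulrA ler_pM2l ?exprn_gt0//; lra.
have Ain n m : (n <= m)%N -> A n <= A m.
  elim: m => [|m IH]; first by rewrite leqn0 => /eqP->.
  rewrite leq_eqVlt => /predU1P[->//|]; rewrite ltnS => /IH h.
  by apply: le_trans h _; case: (key m) => _ _ _ _ [_ _ _ []].
have Cin n m : (n <= m)%N -> C n <= C m.
  elim: m => [|m IH]; first by rewrite leqn0 => /eqP->.
  rewrite leq_eqVlt => /predU1P[->//|]; rewrite ltnS => /IH h.
  by apply: le_trans h _; case: (key m) => _ _ _ _ [_ _ _ []].
have Bin n m : (n <= m)%N -> B m <= B n.
  elim: m => [|m IH]; first by rewrite leqn0 => /eqP->.
  rewrite leq_eqVlt => /predU1P[->//|]; rewrite ltnS => /IH h.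
  by apply: le_trans _ h; case: (key m) => _ _ _ _ [_ _ _ []].
have Din n m : (n <= m)%N -> D m <= D n.
  elim: m => [|m IH]; first by rewrite leqn0 => /eqP->.
  rewrite leq_eqVlt => /predU1P[->//|]; rewrite ltnS => /IH h.
  by apply: le_trans _ h; case: (key m) => _ _ _ _ [_ _ _ []].
have AB n m : A n <= B m.
  case: (leqP n m) => nm.
    by apply: le_trans (Ain _ _ nm) _; case: (key m) => /andP[].
  by apply: le_trans _ (Bin _ _ (ltnW nm)); case: (key n) => /andP[].
have CD n m : C n <= D m.
  case: (leqP n m) => nm.
    by apply: le_trans (Cin _ _ nm) _; case: (key m) => _ _ /andP[].
  by apply: le_trans _ (Din _ _ (ltnW nm)); case: (key n) => _ _ /andP[].
have sA : has_sup (range A).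
  by split; [exists (A 0), 0|exists (B 0) => _ [n _ <-]; exact: AB].
have sC : has_sup (range C).
  by split; [exists (C 0), 0|exists (D 0) => _ [n _ <-]; exact: CD].
have As n : A n <= sup (range A) by apply: ub_le_sup; [case: sA|exists n].
have Cs n : C n <= sup (range C) by apply: ub_le_sup; [case: sC|exists n].
have sB n : sup (range A) <= B n.
  by apply: ge_sup; [case: sA|move=> _ [m _ <-]; exact: AB].
have sD n : sup (range C) <= D n.
  by apply: ge_sup; [case: sC|move=> _ [m _ <-]; exact: CD].
exists (sup (range A)), (sup (range C)); split.
  by split; apply/andP; split; [exact: As 0|exact: sB 0|exact: Cs 0|exact: sD 0].
move=> n; exists (A n), (B n), (C n), (D n).
have [/andP[aA _] Bb /andP[cC _] Dd [eB eD le4 _]] := key n.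
by rewrite aA Bb cC Dd As sB Cs sD.
Qed.

(** By the mean value theorem [rect_diff FP a b c d] is
[(P x d - P x c) * (b - a)] for some [x], which is close to
[k * (b - a) * (d - c)], with [k] the derivative of [P] in the second variable.
In the same way [rect_diff FQ a b c d] is close to the product of
[(b - a) * (d - c)] by the derivative of [Q] in the first variable.  That these
two derivatives are the same [k] is a Cauchy-Riemann equation. *)
Lemma goursat_local FP FQ P Q s t p k q (e : R) : 0 < e ->
  real_diff P s t p k -> real_diff Q s t k q ->
  exists2 del, 0 < del & forall a b c d,
    a <= s <= b -> c <= t <= d -> b - a <= del -> d - c <= del ->
    (forall s' t', a <= s' <= b -> c <= t' <= d ->
      is_derive s' 1 (FP^~ t') (P s' t') /\ is_derive t' 1 (FQ s') (Q s' t')) ->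
    `|rect_diff FP a b c d - rect_diff FQ a b c d| <=
      e * ((b - a) + (d - c)) ^+ 2.
Proof.
move=> e0 dP dQ.
have e20 : 0 < e / 2 by rewrite divr_gt0.
have [d1 d10 h1] := dP _ e20; have [d2 d20 h2] := dQ _ e20.
exists (Num.min d1 d2); first by rewrite lt_min d10.
move=> a b c d /andP[as_ sb] /andP[ct td]; rewrite !le_min.
move=> /andP[ab1 ab2] /andP[cd1 cd2] der.
have EP : `|rect_diff FP a b c d - k * (b - a) * (d - c)| <=
    e * (b - a) * ((b - a) + (d - c)).
  have ab : a <= b by lra.
  have [||x xab Ex] := @MVT_segment R (fun x => FP x d - FP x c)
      (fun x => P x d - P x c) a b ab.
  - move=> x; rewrite in_itv/= => /andP[ax xb].
    have [||D1 _] := der x d; [by lra|by lra|].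
    have [||D2 _] := der x c; [by lra|by lra|].
    exact: is_deriveB.
  - apply: derivable_within_continuous => x; rewrite in_itv/= => /andP[ax xb].
    have [||[D1 _] _] := der x d; [by lra|by lra|].
    have [||[D2 _] _] := der x c; [by lra|by lra|].
    exact: derivableB.
  move: xab; rewrite in_itv/= => /andP[ax xb].
  have {Ex} E : rect_diff FP a b c d = (P x d - P x c) * (b - a).
    by rewrite -Ex /rect_diff; ring.
  have {E} -> : rect_diff FP a b c d - k * (b - a) * (d - c) =
    ((P x d - P s t - p * (x - s) - k * (d - t)) -
    (P x c - P s t - p * (x - s) - k * (c - t))) * (b - a).
    by rewrite E; ring.
  rewrite normrM [`|b - a|]ger0_norm ?subr_ge0// mulrAC ler_wpM2r ?subr_ge0//.
  have xs : `|x - s| <= b - a by rewrite ler_norml; lra.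
  have dt : `|d - t| <= d - c by rewrite ler_norml; lra.
  have ct' : `|c - t| <= d - c by rewrite ler_norml; lra.
  have k1 := h1 x d (le_trans xs ab1) (le_trans dt cd1).
  have k2 := h1 x c (le_trans xs ab1) (le_trans ct' cd1).
  apply: le_trans (ler_normB _ _) _.
  apply: le_trans (lerD k1 k2) _.
  have : e / 2 * (`|x - s| + `|d - t|) <= e / 2 * (b - a + (d - c)).
    by rewrite ler_pM2l//; lra.
  have : e / 2 * (`|x - s| + `|c - t|) <= e / 2 * (b - a + (d - c)).
    by rewrite ler_pM2l//; lra.
  lra.
have EQ : `|rect_diff FQ a b c d - k * (b - a) * (d - c)| <=
    e * (d - c) * ((b - a) + (d - c)).
  have cd : c <= d by lra.
  have [||y ycd Ey] := @MVT_segment R (fun y => FQ b y - FQ a y)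
      (fun y => Q b y - Q a y) c d cd.
  - move=> y; rewrite in_itv/= => /andP[cy yd].
    have [||_ D1] := der b y; [by lra|by lra|].
    have [||_ D2] := der a y; [by lra|by lra|].
    exact: is_deriveB.
  - apply: derivable_within_continuous => y; rewrite in_itv/= => /andP[cy yd].
    have [||_ [D1 _]] := der b y; [by lra|by lra|].
    have [||_ [D2 _]] := der a y; [by lra|by lra|].
    exact: derivableB.
  move: ycd; rewrite in_itv/= => /andP[cy yd].
  have {Ey} E : rect_diff FQ a b c d = (Q b y - Q a y) * (d - c).
    by rewrite -Ey /rect_diff; ring.
  have {E} -> : rect_diff FQ a b c d - k * (b - a) * (d - c) =
    ((Q b y - Q s t - k * (b - s) - q * (y - t)) -
    (Q a y - Q s t - k * (a - s) - q * (y - t))) * (d - c).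
    by rewrite E; ring.
  rewrite normrM [`|d - c|]ger0_norm ?subr_ge0// mulrAC ler_wpM2r ?subr_ge0//.
  have yt : `|y - t| <= d - c by rewrite ler_norml; lra.
  have bs : `|b - s| <= b - a by rewrite ler_norml; lra.
  have as' : `|a - s| <= b - a by rewrite ler_norml; lra.
  have k1 := h2 b y (le_trans bs ab2) (le_trans yt cd2).
  have k2 := h2 a y (le_trans as' ab2) (le_trans yt cd2).
  apply: le_trans (ler_normB _ _) _.
  apply: le_trans (lerD k1 k2) _.
  have : e / 2 * (`|b - s| + `|y - t|) <= e / 2 * (b - a + (d - c)).
    by rewrite ler_pM2l//; lra.
  have : e / 2 * (`|a - s| + `|y - t|) <= e / 2 * (b - a + (d - c)).
    by rewrite ler_pM2l//; lra.
  lra.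
have -> : rect_diff FP a b c d - rect_diff FQ a b c d =
  (rect_diff FP a b c d - k * (b - a) * (d - c)) -
  (rect_diff FQ a b c d - k * (b - a) * (d - c)) by ring.
apply: le_trans (ler_normB _ _) _; apply: le_trans (lerD EP EQ) _.
by rewrite -mulrDl -mulrDr expr2 mulrA.
Qed.

(** By [goursat_local] the difference on the [n]-th nested rectangle is at most a
constant times [e * 4^-n], while the passage to it loses a factor [4^n] only. *)
Lemma goursat FP FQ P Q a b c d : a <= b -> c <= d ->
  (forall s t, a <= s <= b -> c <= t <= d ->
      [/\ is_derive s 1 (FP^~ t) (P s t), is_derive t 1 (FQ s) (Q s t) &
       exists p k q, real_diff P s t p k /\ real_diff Q s t k q]) ->
  rect_diff FP a b c d = rect_diff FQ a b c d.
Proof.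
move=> ab cd H; pose G s t := FP s t - FQ s t.
have GE a' b' c' d' : rect_diff G a' b' c' d' =
  rect_diff FP a' b' c' d' - rect_diff FQ a' b' c' d'.
  by rewrite /rect_diff /G; ring.
apply/eqP; rewrite -subr_eq0 -GE -normr_eq0 eq_le normr_ge0 andbT.
apply/ler_addgt0Pr => e0 e00; rewrite add0r.
have [s [t [[sab tcd] nested]]] := rect_diff_nested G ab cd.
have [_ _ [p [k [q [dP dQ]]]]] := H s t sab tcd.
pose T := (b - a) + (d - c).
have T0 : 0 <= T by rewrite /T; lra.
pose e := e0 / (T ^+ 2 + 1).
have e_gt0 : 0 < e by rewrite divr_gt0// ltr_wpDl ?sqr_ge0.
have [del del0 local] := goursat_local FP FQ e_gt0 dP dQ.
have [n hn] : exists n, T / 2 ^+ n <= del.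
  have T10 : 0 < T + 1 by lra.
  have [n _ hn] := near_infty_natSinv_expn_lt (PosNum (divr_gt0 del0 T10)).
  exists n; have := hn n (leqnn n) => /=; rewrite ltr_pdivlMr// mul1r => hn'.
  apply: le_trans (ltW hn'); rewrite mulrC ler_wpM2l ?invr_ge0 ?exprn_ge0//; lra.
have [a' [b' [c' [d' [/andP[aa as'] /andP[sb bb] /andP[cc ct] /andP[td dd]
  [eb ed le4]]]]]] := nested n.
have n2 : 0 < (2 ^+ n)^-1 :> R by rewrite invr_gt0 exprn_gt0.
have ba : (b - a) / 2 ^+ n <= T / 2 ^+ n by rewrite ler_pM2r// /T; lra.
have dc : (d - c) / 2 ^+ n <= T / 2 ^+ n by rewrite ler_pM2r// /T; lra.
have := @local a' b' c' d'; rewrite as' sb ct td eb ed -mulrDl -/T -GE.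
move=> /(_ isT isT (le_trans ba hn) (le_trans dc hn)) H'.
have {}H' : `|rect_diff G a' b' c' d'| <= e * (T / 2 ^+ n) ^+ 2.
  apply: H' => s' t' /andP[h1 h2] /andP[h3 h4].
  by have [] := H s' t'; [lra|lra|].
apply: (le_trans le4).
apply: (@le_trans _ _ (4 ^+ n * (e * (T / 2 ^+ n) ^+ 2))).
  by rewrite ler_pM2l// exprn_gt0.
have -> : 4 ^+ n * (e * (T / 2 ^+ n) ^+ 2) = e * T ^+ 2.
  have -> : 4 ^+ n = (2 ^+ n) ^+ 2 :> R.
    by rewrite -exprM mulnC exprM; congr (_ ^+ n); ring.
  by field; rewrite expf_eq0 pnatr_eq0 andbF.
rewrite /e mulrAC ler_pdivrMr ?ler_pM2l ?ltr_wpDl ?sqr_ge0//; lra.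
Qed.
End Goursat.

(** * Mean values over circles *)

Section CircleIntegral.
Context {R : realType}.
Implicit Types (u v : R -> R).
Local Notation mu := (@lebesgue_measure R).

Definition cint u : R := \int[mu]_(t in `[0, 2 * pi]) u t.

Lemma pi2_gt0 : 0 < 2 * pi :> R.
Proof. by rewrite mulr_gt0// pi_gt0. Qed.

Lemma continuous_itv_integrable u (a b : R) : continuous u ->
  mu.-integrable `[a, b] (EFin \o u).
Proof.
move=> cu; apply: continuous_compact_integrable; first exact: segment_compact.
exact: continuous_subspaceT.
Qed.

Lemma cintD u v : continuous u -> continuous v ->
  cint (fun t => u t + v t) = cint u + cint v.
Proof. by move=> cu cv; rewrite /cint RintegralD//; apply: continuous_itv_integrable. Qed.

Lemma cintZ k u : continuous u -> cint (fun t => k * u t) = k * cint u.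
Proof. by move=> cu; rewrite /cint RintegralZl//; apply: continuous_itv_integrable. Qed.

Lemma cint_cst k : cint (fun=> k) = 2 * pi * k.
Proof.
rewrite /cint Rintegral_cst//= lebesgue_measure_itv/= lte_fin pi2_gt0.
by rewrite -EFinB/= subr0 mulrC.
Qed.

Lemma le_cint u v : continuous u -> continuous v ->
  (forall t, u t <= v t) -> cint u <= cint v.
Proof.
by move=> cu cv uv; apply: le_Rintegral => //; apply: continuous_itv_integrable.
Qed.

End CircleIntegral.

Section PeriodicMean.
Context {R : realType}.
Implicit Types (z w d : R[i]) (f g : R[i] -> R[i]).
Local Notation nc := (@Normc.normc R).
Local Notation mu := (@lebesgue_measure R).

(** With [g' = A + i B], the Cauchy-Riemann equations say that the imaginary part
has gradient [(B, A)] and the real part [(A, - B)]; the shared [A] is the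
coefficient [k] of [goursat]. *)
Lemma cdiff_real_diff g s t (A B : R) : cdiff g (s +i* t) (A +i* B) ->
  real_diff (fun s t => complex.Im (g (s +i* t))) s t B A /\
  real_diff (fun s t => complex.Re (g (s +i* t))) s t A (- B).
Proof.
move=> gd.
suff H : forall e : R, 0 < e -> exists2 del : R, 0 < del & forall s' t' : R,
    `|s' - s| <= del -> `|t' - t| <= del ->
    nc (g (s' +i* t') - g (s +i* t) - (A +i* B) * ((s' - s) +i* (t' - t)))
    <= e * (`|s' - s| + `|t' - t|).
  split=> e e0; have [del del0 {}H] := H e e0; exists del => // s' t' hs ht.
    apply: le_trans (H s' t' hs ht); apply: le_trans (Im_le_nc _).
    by rewrite !ImB /= opprD addrA addrAC.
  apply: le_trans (H s' t' hs ht); apply: le_trans (Re_le_nc _).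
  by rewrite !ReB /= opprB mulNr opprK addrA addrAC.
move=> e e0; have [del del0 H] := gd e e0.
exists (del / 2); first by rewrite divr_gt0.
move=> s' t' hs ht; set w := (s' - s) +i* (t' - t).
have -> : s' +i* t' = (s +i* t) + w by rewrite /w; simpc; congr (_ +i* _); ring.
have wd : nc w <= `|s' - s| + `|t' - t| := nc_le_ReIm w.
by apply: le_trans (H w _) _; [lra|rewrite ler_pM2l].
Qed.

Lemma continuous_primitive (u : R -> R) (a x b : R) : a < x -> x < b ->
  (forall y, a <= y <= b -> {for y, continuous u}) ->
  is_derive x (1 : R) (fun x : R => \int[mu]_(t in `[a, x]) u t) (u x).
Proof.
move=> ax xb cu.
have [|||d1 d2] := @continuous_FTC1_closed R u a x b xb.
- apply: continuous_compact_integrable; first exact: segment_compact.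
  apply: continuous_in_subspaceT => y; rewrite inE/= in_itv/=; exact: cu.
- exact: ax.
- by apply: cu; rewrite (ltW ax) (ltW xb).
by apply: DeriveDef; [exact: d1|rewrite -derive1E; exact: d2].
Qed.

(** The integrals of the imaginary part of [g] along the horizontal sides of
[[s1, s2] x [0, 2 pi]] cancel by periodicity, so the integrals of its real part
along the vertical sides agree. *)
Lemma periodic_circle g (S : R) :
  (forall s t : R, s < S -> exists d, cdiff g (s +i* t) d) ->
  (forall s : R, g (s +i* (2 * pi)) = g (s +i* 0)) ->
  forall s1 s2 : R, s1 < s2 -> s2 < S ->
  cint (fun t => complex.Re (g (s1 +i* t))) = cint (fun t => complex.Re (g (s2 +i* t))).
Proof.
move=> gd gper s1 s2 s12 s2S.
pose P s t := complex.Im (g (s +i* t)); pose Q s t := complex.Re (g (s +i* t)).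
have cP s t : s < S -> {for s, continuous (P^~ t)}.
  by move=> sS; have [d gd'] := gd s t sS; exact: ccont_Im (ccont_horiz gd').
have cQ s t : s < S -> {for t, continuous (Q s)}.
  by move=> sS; have [d gd'] := gd s t sS; exact: ccont_Re (ccont_vert gd').
pose FP s t := \int[mu]_(x in `[s1 - 1, s]) P x t.
pose FQ s t := \int[mu]_(x in `[(-1), t]) Q s x.
have p2 := @pi2_gt0 R.
have := @goursat R FP FQ P Q s1 s2 0 (2 * pi) (ltW s12) (ltW p2).
have -> : rect_diff FP s1 s2 0 (2 * pi) = 0.
  have FPE s : FP s (2 * pi) = FP s 0.
    by apply: eq_Rintegral => x _; rewrite /P gper.
  by rewrite /rect_diff !FPE subrr sub0r addrC subrr.
have FQE s : s < S -> FQ s (2 * pi) - FQ s 0 = cint (Q s).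
  move=> sS; have iQ (a b : R) : mu.-integrable `[a, b] (EFin \o Q s).
    by apply: continuous_itv_integrable => t; exact: cQ.
  have [m10 p2'] : -1 <= 0 :> R /\ 0 <= 2 * pi :> R by split; lra.
  rewrite /FQ Rintegral_itvB ?bnd_simp//.
  rewrite Rintegral_itv_obnd_cbnd//; apply: integrableS (iQ 0 (2 * pi)) => //.
  exact: subset_itv_oc_cc.
move=> H; apply/eqP; rewrite eq_sym -subr_eq0 -!FQE//; last exact: lt_trans s2S.
rewrite opprB addrA [_ + FQ s1 0]addrC addrC addrA; apply/eqP/esym.
transitivity (rect_diff FQ s1 s2 0 (2 * pi)); last by rewrite /rect_diff; ring.
apply: H => s t /andP[s1s ss2] /andP[t0 t2].
have sS : s < S by apply: le_lt_trans s2S.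
split.
- apply: (@continuous_primitive (P^~ t) (s1 - 1) s ((s2 + S) / 2)); [lra|lra|].
  by move=> y /andP[_ yS]; apply: cP; lra.
- apply: (@continuous_primitive (Q s) (-1) t (2 * pi + 1)); [lra|lra|].
  by move=> y _; apply: cQ.
- have [[A B] gd'] := gd s t sS.
  by exists B, A, (- B); exact: cdiff_real_diff.
Qed.

(** The integral does not depend on [s], so it can be evaluated as [s] tends to
[-oo]. *)
Lemma periodic_mean g (S L : R) :
  (forall s t : R, s < S -> exists d, cdiff g (s +i* t) d) ->
  (forall s : R, g (s +i* (2 * pi)) = g (s +i* 0)) ->
  (forall e : R, 0 < e -> exists s0 : R, forall s t : R, s <= s0 ->
     `|complex.Re (g (s +i* t)) - L| <= e) ->
  forall s : R, s < S -> cint (fun t => complex.Re (g (s +i* t))) = 2 * pi * L.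
Proof.
move=> gd gper glim s sS; apply/eqP; rewrite -subr_eq0 -normr_eq0 eq_le normr_ge0 andbT.
have p2 := @pi2_gt0 R.
apply/ler_addgt0Pr => e e0; rewrite add0r.
have e1 : 0 < e / (2 * pi) by rewrite divr_gt0.
have [s0 Hs0] := glim _ e1.
pose s' := Num.min s0 (s - 1).
have s's : s' < s by rewrite gt_min; apply/orP; right; lra.
rewrite -(periodic_circle gd gper s's sS).
have cQ : continuous (fun t => complex.Re (g (s' +i* t))).
  move=> t; have [d gd'] := gd s' t (lt_trans s's sS).
  exact: ccont_Re (ccont_vert gd').
have bnd t : `|complex.Re (g (s' +i* t)) - L| <= e / (2 * pi).
  by apply: Hs0; rewrite ge_min lexx.
have k1 : cint (fun t => complex.Re (g (s' +i* t))) <= 2 * pi * (L + e / (2 * pi)).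
  rewrite -cint_cst; apply: le_cint => //; first by move=> t; exact: cvg_cst.
  by move=> t; have := bnd t; rewrite ler_distl => /andP[].
have k2 : 2 * pi * (L - e / (2 * pi)) <= cint (fun t => complex.Re (g (s' +i* t))).
  rewrite -cint_cst; apply: le_cint => //; first by move=> t; exact: cvg_cst.
  by move=> t; have := bnd t; rewrite ler_distl => /andP[].
rewrite mulrDr mulrCA divff ?gt_eqF// mulr1 in k1.
rewrite mulrBr mulrCA divff ?gt_eqF// mulr1 in k2.
by rewrite ler_norml; apply/andP; split; lra.
Qed.

End PeriodicMean.

Section MeanValue.
Context {R : realType}.
Implicit Types (z w d : R[i]) (f g : R[i] -> R[i]).
Local Notation nc := (@Normc.normc R).

(** Kept in coordinates, so that translating the centre horizontally and changing
the height of a point are visible. *)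
Definition circ z (r t : R) : R[i] :=
  (complex.Re z + r * cos t) +i* (complex.Im z + r * sin t).

Lemma circE z r t : circ z r t = z + r%:C * cexp (0 +i* t).
Proof.
by case: z => x y; rewrite /circ /cexp/= expR0 !mul1r /real_complex_def; simpc.
Qed.

Lemma circ_expE z (s t : R) : circ z (expR s) t = z + cexp (s +i* t).
Proof. by case: z => x y; rewrite /circ /cexp/=; simpc. Qed.

Lemma Im_circ_gt0 z r t : 0 <= r -> r < complex.Im z -> 0 < complex.Im (circ z r t).
Proof.
move=> r0 rz; rewrite /circ/=.
have : - r <= r * sin t.
  by rewrite -mulrN1 ler_wpM2l// sin_geN1.
lra.
Qed.

Lemma nc_circ z r t : 0 <= r -> nc (circ z r t - z) = r.
Proof.
by move=> r0; rewrite circE addrC addKr ncM nc_real ger0_norm// nc_cexp expR0 mulr1.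
Qed.

Section holomorphic.
Variables (f f' : R[i] -> R[i]).
Hypothesis fd : forall z, 0 < complex.Im z -> cdiff f z (f' z).

Lemma ccont_circ z r t : 0 < r -> r < complex.Im z -> ccont (fun t => f (circ z r t)) t.
Proof.
move=> r0 rz; have -> : (fun t => f (circ z r t)) =
    (fun t => (fun w => f (z + cexp w)) (ln r +i* t)).
  by apply/funext => s; rewrite -circ_expE lnK.
suff : cdiff (fun w => f (z + cexp w)) (ln r +i* t) (f' (circ z r t) * cexp (ln r +i* t)).
  exact: ccont_vert.
apply: (@cdiff_comp _ (fun w => z + cexp w) f).
  by apply: cdiff_eq (cdiff_add (cdiff_cst _ _) (cdiff_cexp _)); rewrite add0r.
rewrite -circ_expE lnK//; apply: fd; apply: Im_circ_gt0 => //; exact: ltW.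
Qed.

(** [periodic_mean] for [w |-> f (z + e^w)].  The factor [a] recovers the imaginary
part of the mean from real parts, and makes it possible to project on the
direction of [f z]. *)
Lemma mean_value z r : 0 < r -> r < complex.Im z -> forall a : R[i],
  cint (fun t => complex.Re (a * f (circ z r t))) = 2 * pi * complex.Re (a * f z).
Proof.
move=> r0 rz a; have z0 := lt_trans r0 rz.
have := @periodic_mean R (fun w => a * f (z + cexp w)) (ln (complex.Im z))
  (complex.Re (a * f z)).
move=> /(_ _ _ _ (ln r)) H; rewrite -H.
- by congr cint; apply/funext => t; rewrite -circ_expE lnK.
- move=> s t sz; exists (a * (f' (z + cexp (s +i* t)) * cexp (s +i* t))).
  apply: (@cdiff_comp _ (fun w => f (z + cexp w)) (fun w => a * w)); last exact: cdiff_lin.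
  apply: (@cdiff_comp _ (fun w => z + cexp w) f).
    by apply: cdiff_eq (cdiff_add (cdiff_cst _ _) (cdiff_cexp _)); rewrite add0r.
  apply: fd; rewrite -circ_expE Im_circ_gt0 ?expR_ge0//.
  by rewrite -(lnK z0) ltr_expR.
- move=> s; have -> : s +i* (2 * pi) = (s +i* 0) + (0 +i* (2 * pi)).
    by simpc.
  by rewrite cexp_period.
- move=> e e0; have n0 : 0 < nc a + 1 by rewrite ltr_wpDl ?nc_ge0.
  have [del del0 Hd] := cdiff_cont (fd z0) (divr_gt0 e0 n0).
  exists (ln del) => s t sd; rewrite -ReB; apply: le_trans (Re_le_nc _) _.
  rewrite -mulrBr ncM.
  apply: (@le_trans _ _ ((nc a + 1) * (e / (nc a + 1)))).
    apply: ler_pM; rewrite ?nc_ge0 ?lerDl//; apply: Hd.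
    by rewrite nc_cexp/= -(lnK del0) ler_expR.
  by rewrite mulrC divfK// gt_eqF.
- by rewrite ltr_ln.
Qed.

(** The quotient [(f w - f z) / (w - z)] is holomorphic off [z] with limit
[f' z], so its circle means are all [f' z]; this is Cauchy's formula for the
derivative. *)
Lemma mean_value_derivative z r : 0 < r -> r < complex.Im z -> forall a : R[i],
  cint (fun t => complex.Re (a * ((f (circ z r t) - f z) * cexp (- (ln r +i* t)))))
  = 2 * pi * complex.Re (a * f' z).
Proof.
move=> r0 rz a; have z0 := lt_trans r0 rz.
have := @periodic_mean R (fun w => a * ((f (z + cexp w) - f z) * cexp (- w)))
  (ln (complex.Im z)) (complex.Re (a * f' z)).
move=> /(_ _ _ _ (ln r)) H; rewrite -H.
- by congr cint; apply/funext => t; rewrite -circ_expE lnK.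
- move=> s t sz.
  set w0 := s +i* t.
  have D1 : cdiff (fun w => f (z + cexp w)) w0 (f' (z + cexp w0) * cexp w0).
    apply: (@cdiff_comp _ (fun w => z + cexp w) f).
      by apply: cdiff_eq (cdiff_add (cdiff_cst _ _) (cdiff_cexp _)); rewrite add0r.
    apply: fd; rewrite -circ_expE Im_circ_gt0 ?expR_ge0//.
    by rewrite -(lnK z0) ltr_expR.
  have D2 : cdiff (fun w => cexp (- w)) w0 (cexp (- 1 * w0) * - 1).
    have -> : (fun w : R[i] => cexp (- w)) = (fun w => cexp (- 1 * w)).
      by apply/funext => w; rewrite mulN1r.
    by apply: (@cdiff_comp _ (fun w => - 1 * w) cexp); [exact: cdiff_lin|exact: cdiff_cexp].
  have D3 := cdiff_mul (cdiff_add D1 (cdiff_cst (- f z) w0)) D2.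
  by have D4 := cdiff_comp D3 (cdiff_lin a _); eexists; exact: D4.
- move=> s; have -> : s +i* (2 * pi) = (s +i* 0) + (0 +i* (2 * pi)).
    by simpc.
  rewrite cexp_period.
  by rewrite opprD -(cexp_period (- (s +i* 0) - _)) subrK.
- move=> e e0; have n0 : 0 < nc a + 1 by rewrite ltr_wpDl ?nc_ge0.
  have [del del0 Hd] := fd z0 (divr_gt0 e0 n0).
  exists (ln del) => s t sd; rewrite -ReB; apply: le_trans (Re_le_nc _) _.
  rewrite -mulrBr ncM.
  apply: (@le_trans _ _ ((nc a + 1) * (e / (nc a + 1)))); last first.
    by rewrite mulrC divfK// gt_eqF.
  apply: ler_pM; rewrite ?nc_ge0 ?lerDl//.
  set w := cexp (s +i* t).
  have ww : w * cexp (- (s +i* t)) = 1 by rewrite -cexpD subrr cexp0.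
  have -> : (f (z + w) - f z) * cexp (- (s +i* t)) - f' z =
      (f (z + w) - f z - f' z * w) * cexp (- (s +i* t)) by rewrite [RHS]mulrBl -mulrA ww mulr1.
  have nw : nc w * nc (cexp (- (s +i* t))) = 1 by rewrite -ncM ww nc1.
  have wd : nc w <= del by rewrite nc_cexp/= -(lnK del0) ler_expR.
  rewrite ncM; apply: le_trans (ler_wpM2r (nc_ge0 _) (Hd w wd)) _.
  by rewrite -mulrA nw mulr1.
- by rewrite ltr_ln.
Qed.

End holomorphic.
End MeanValue.

(** * Circle means of powers of the modulus *)

Section PowerMean.
Context {R : realType}.
Local Notation mu := (@lebesgue_measure R).

(** The tangent of the convex function [s `^ q] at [s0], from Young's inequality
for [s] and [s0 `^ (q - 1)]. *)
Lemma powR_tangent (q s s0 : R) : 1 <= q -> 0 <= s -> 0 < s0 ->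
  s0 `^ q + q * s0 `^ (q - 1) * (s - s0) <= s `^ q.
Proof.
rewrite le_eqVlt => /predU1P[<-|q1] s0' s00.
  by rewrite subrr powRr0 !powRr1 ?(ltW s00)//; lra.
have q0 : 0 < q by lra.
have q10 : 0 < q - 1 by lra.
have := @conjugate_powR R s (s0 `^ (q - 1)) q (q / (q - 1)) s0' (powR_ge0 _ _) q0.
rewrite divr_gt0// -powRrM => /(_ isT) H.
have {}H : s * s0 `^ (q - 1) <= s `^ q / q + s0 `^ q * ((q - 1) / q).
  have := H; rewrite invf_div [(q - 1) * (q / _)]mulrCA divff ?gt_eqF// mulr1.
  by apply; field; rewrite gt_eqF.
have E : s0 * s0 `^ (q - 1) = s0 `^ q by apply: mulr_powRB1 => //; exact: ltW.
have : q * (s * s0 `^ (q - 1)) <= s `^ q + (q - 1) * s0 `^ q.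
  rewrite -(ler_pM2l q0) in H; apply: le_trans H _.
  by rewrite le_eqVlt; apply/orP; left; apply/eqP; field; rewrite gt_eqF.
by rewrite mulrBr -mulrA -[q * _ * s0]mulrA [_ * s0]mulrC E [_ * s]mulrC; lra.
Qed.

Lemma ae_continuous_eq0 (u : R -> R) (D : set R) : open D ->
  {ae mu, forall t, D t -> u t = 0} -> (forall t, D t -> {for t, continuous u}) ->
  forall t, D t -> u t = 0.
Proof.
move=> oD u0 cu t Dt; apply/eqP/negPn/negP => ut0.
have : \forall s \near t, D s /\ u s != 0.
  near=> s; split; near: s; first exact: open_nbhs_nbhs.
  have /cvgrPdist_lt/(_ `|u t|) := cu t Dt; rewrite normr_gt0 => /(_ ut0).
  apply: filterS => s; apply: contraTN => /eqP ->.
  by rewrite subr0 ltxx.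
move=> /nbhs_ballP[e /= e0 He].
have [B [mB B0 uB]] := u0.
have : (mu (ball t e) <= mu B)%E.
  apply: le_measure; rewrite ?inE//; first exact: measurable_ball.
  by move=> s /He[Ds us0]; apply: uB => /(_ Ds) us; move: us0; rewrite us eqxx.
have h0 : (mu B <= 0)%E := eq_ind_r (fun x => (x <= 0)%E) (lexx _) B0.
move=> /le_trans/(_ h0); rewrite (lebesgue_measure_ball _ (ltW e0)).
by rewrite lee_fin leNgt pmulrn_lgt0// e0.
Unshelve. all: by end_near. Qed.

(** The integrand vanishes almost everywhere, hence everywhere by continuity. *)
Lemma cint_eq0 (v : R -> R) : continuous v -> (forall t, 0 <= v t) -> cint v <= 0 ->
  forall t : R, 0 < t < 2 * pi -> v t = 0.
Proof.
move=> cv v0 iv; have iv' := @continuous_itv_integrable R v 0 (2 * pi) cv.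
have E : cint v = 0.
  by apply/eqP; rewrite eq_le iv; apply: Rintegral_ge0.
have : (\int[mu]_(t in `[0%R, (2 * pi)%R]) `|(v t)%:E|)%E = 0%E.
  under eq_integral do rewrite gee0_abs ?lee_fin//.
  have fi : (\int[mu]_(t in `[0%R, (2 * pi)%R]) (EFin \o v) t)%E \is a fin_num.
    by apply: integrable_fin_num.
  by rewrite -(fineK fi); congr EFin.
have mv : measurable_fun (`[0%R, (2 * pi)%R]%classic : set R) (EFin \o v).
  exact: measurable_int iv'.
move/ae_eq_integral_abs => H t tpi.
have {H} ae0 := H (measurable_itv _) mv.
have : {ae mu, forall t, (`]0%R, (2 * pi)%R[%classic : set R) t -> v t = 0}.
  have sub (s : R) : s \in `]0, 2 * pi[%R -> s \in `[0, 2 * pi]%R.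
    by rewrite !in_itv/= => /andP[s1 s2]; rewrite !ltW.
  by apply: filterS ae0 => s /= H /sub/H[].
move=> H; apply: (@ae_continuous_eq0 v `]0%R, (2 * pi)%R[%classic _ H) => //.
by move=> s _; exact: cv.
Qed.

(** Jensen's inequality, by integrating the tangent of [s `^ p] at [m]. *)
Lemma le_cint_pow (a : R -> R) (m p : R) : 1 <= p -> 0 <= m -> continuous a ->
  (forall t, 0 <= a t) -> 2 * pi * m <= cint a ->
  2 * pi * m `^ p <= cint (fun t => a t `^ p).
Proof.
move=> p1 m0 ca a0 ma; have p0 : 0 < p by lra.
have cap : continuous (fun t => a t `^ p) by move=> t; apply: continuous_powR => //; exact: ca.
move: m0; rewrite le_eqVlt => /predU1P[m0|m0].
  by rewrite -m0 powR0 ?gt_eqF// mulr0; apply: Rintegral_ge0 => t _; exact: powR_ge0.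
pose k := p * m `^ (p - 1).
have k0 : 0 <= k by rewrite mulr_ge0 ?powR_ge0 ?ltW.
have : cint (fun t => (m `^ p - k * m) + k * a t) <= cint (fun t => a t `^ p).
  apply: le_cint => //.
    by move=> t; apply: cvgD; [exact: cvg_cst|apply: cvgM; [exact: cvg_cst|exact: ca]].
  by move=> t; have := powR_tangent p1 (a0 t) m0; rewrite -/k; lra.
rewrite cintD; [|by move=> t; exact: cvg_cst|]; last first.
  by move=> t; apply: cvgM; [exact: cvg_cst|exact: ca].
rewrite cint_cst cintZ//; apply: le_trans.
have : k * (2 * pi * m) <= k * cint a by rewrite ler_wpM2l.
lra.
Qed.

End PowerMean.

Section HolomorphicEstimates.
Context {R : realType}.
Implicit Types (z w d : R[i]) (f g : R[i] -> R[i]) (r p : R).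
Local Notation nc := (@Normc.normc R).

Lemma conj_mul_nc z : complex.Re (conjc z * z) = nc z ^+ 2.
Proof. by rewrite nc_sqr; case: z => a b /=; ring. Qed.

Lemma nc_conj z : nc (conjc z) = nc z.
Proof. by case: z => a b /=; rewrite sqrrN. Qed.

(** Splits [|w|^2] into a part affine in [w] and the square [|w - z|^2]; the circle
mean of the first is known when [w] is a value of a holomorphic function on a
circle and [z] the value at its centre. *)
Lemma nc_sqr_expand z w :
  nc w ^+ 2 = nc z ^+ 2 + 2 * (complex.Re (conjc z * w) - nc z ^+ 2) + nc (w - z) ^+ 2.
Proof. by rewrite !nc_sqr; case: z => a b; case: w => c d /=; ring. Qed.

Variables (f f' : R[i] -> R[i]).
Hypothesis fd : forall z, 0 < complex.Im z -> cdiff f z (f' z).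

Lemma continuous_nc_circ z r c : 0 < r -> r < complex.Im z ->
  continuous (fun t => nc (f (circ z r t) - c)).
Proof.
move=> r0 rz t; apply: ccont_nc; apply: ccontB; last exact: ccont_cst.
exact: ccont_circ fd _ _ _ _ _.
Qed.

Lemma continuous_nc_circ0 z r : 0 < r -> r < complex.Im z ->
  continuous (fun t => nc (f (circ z r t))).
Proof.
by move=> r0 rz t; apply: ccont_nc; exact: ccont_circ fd _ _ _ _ _.
Qed.

(** Projection of [f] on the direction of [f z]: the real part of
[conjc (f z) * f w] is at most [|f z| * |f w|], and its mean is [|f z|^2]. *)
Lemma nc_mean z r : 0 < r -> r < complex.Im z ->
  2 * pi * nc (f z) <= cint (fun t => nc (f (circ z r t))).
Proof.
move=> r0 rz; have cf := continuous_nc_circ0 r0 rz.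
have [fz0|fz0] := eqVneq (nc (f z)) 0.
  by rewrite fz0 mulr0; apply: Rintegral_ge0 => t _; exact: nc_ge0.
have {}fz0 : 0 < nc (f z) by rewrite lt0r fz0 nc_ge0.
rewrite -(ler_pM2l fz0) mulrCA -expr2 -conj_mul_nc -(mean_value fd r0 rz) -cintZ//.
apply: le_cint => [t|t|t].
- apply: ccont_Re; apply: ccontM; first exact: ccont_cst.
  exact: ccont_circ fd _ _ _ _ _.
- by apply: cvgM; [exact: cvg_cst|exact: cf].
- by rewrite -{1}(nc_conj (f z)) -ncM; apply: le_trans (Re_le_nc _); exact: ler_norm.
Qed.

(** Cauchy's estimate for the derivative. *)
Lemma nc_derivative_mean z r : 0 < r -> r < complex.Im z ->
  2 * pi * (r * nc (f' z)) <= cint (fun t => nc (f (circ z r t) - f z)).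
Proof.
move=> r0 rz; have cf := @continuous_nc_circ z r (f z) r0 rz.
have [fz0|fz0] := eqVneq (nc (f' z)) 0.
  by rewrite fz0 !mulr0; apply: Rintegral_ge0 => t _; exact: nc_ge0.
have {}fz0 : 0 < nc (f' z) by rewrite lt0r fz0 nc_ge0.
have k0 : 0 < nc (f' z) / r by rewrite divr_gt0.
rewrite -(ler_pM2l k0).
have -> : nc (f' z) / r * (2 * pi * (r * nc (f' z))) = 2 * pi * nc (f' z) ^+ 2.
  by field; rewrite gt_eqF.
rewrite -conj_mul_nc -(mean_value_derivative fd r0 rz) -cintZ//.
apply: le_cint => [t|t|t].
- apply: ccont_Re; apply: ccontM; first exact: ccont_cst.
  apply: ccontM.
    by apply: ccontB; [exact: ccont_circ fd _ _ _ _ _|exact: ccont_cst].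
  suff : cdiff (fun w => cexp (- w)) (ln r +i* t) (cexp (- 1 * (ln r +i* t)) * - 1).
    exact: (@ccont_vert _ (fun w => cexp (- w))).
  have -> : (fun w : R[i] => cexp (- w)) = (fun w => cexp (- 1 * w)).
    by apply/funext => w; rewrite mulN1r.
  by apply: (@cdiff_comp _ (fun w => - 1 * w) cexp); [exact: cdiff_lin|exact: cdiff_cexp].
- by apply: cvgM; [exact: cvg_cst|exact: cf].
- apply: le_trans (ler_norm _) _; apply: le_trans (Re_le_nc _) _.
  rewrite !ncM nc_conj nc_cexp/= expRN lnK//.
  by rewrite mulrCA mulrC -!mulrA lexx.
Qed.

Lemma nc_mean_pow p z r : 1 <= p -> 0 < r -> r < complex.Im z ->
  2 * pi * nc (f z) `^ p <= cint (fun t => nc (f (circ z r t)) `^ p).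
Proof.
move=> p1 r0 rz; apply: le_cint_pow => //; first exact: nc_ge0.
- exact: continuous_nc_circ0.
- by move=> t; exact: nc_ge0.
- exact: nc_mean.
Qed.

Lemma powRD_le (a b p : R) : 0 < p -> 0 <= a -> 0 <= b ->
  (a + b) `^ p <= 2 `^ p * (a `^ p + b `^ p).
Proof.
move=> p0 a0 b0; have two : (0 : R) <= 2 by [].
have [ab|ab] := leP a b.
  apply: (@le_trans _ _ ((2 * b) `^ p)).
    by apply: ge0_ler_powR; rewrite ?nnegrE ?(ltW p0)//; lra.
  by rewrite powRM// ler_wpM2l ?powR_ge0// lerDr powR_ge0.
apply: (@le_trans _ _ ((2 * a) `^ p)).
  by apply: ge0_ler_powR; rewrite ?nnegrE ?(ltW p0)//; lra.
by rewrite powRM// ler_wpM2l ?powR_ge0// lerDl powR_ge0.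
Qed.

Lemma derivative_pow_mean p z r : 1 <= p -> 0 < r -> r < complex.Im z ->
  2 * pi * (r * nc (f' z)) `^ p <=
  2 `^ p * (cint (fun t => nc (f (circ z r t)) `^ p) + 2 * pi * nc (f z) `^ p).
Proof.
move=> p1 r0 rz; have p0 : 0 < p by lra.
have cp c : continuous (fun t => nc (f (circ z r t) - c) `^ p).
  by move=> t; apply: continuous_powR => //; [move=> s; exact: nc_ge0|exact: continuous_nc_circ].
have cp0 : continuous (fun t => nc (f (circ z r t)) `^ p).
  by move=> t; apply: continuous_powR => //; [move=> s; exact: nc_ge0|exact: continuous_nc_circ0].
have c0 : continuous (fun _ : R => nc (f z) `^ p) by move=> t; exact: cvg_cst.
have c1 : continuous (fun t => nc (f (circ z r t)) `^ p + nc (f z) `^ p).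
  by move=> t; apply: cvgD; [exact: cp0|exact: c0].
apply: (@le_trans _ _ (cint (fun t => nc (f (circ z r t) - f z) `^ p))).
  apply: le_cint_pow => //; first by rewrite mulr_ge0 ?nc_ge0 ?ltW.
  - exact: continuous_nc_circ.
  - by move=> t; exact: nc_ge0.
  - exact: nc_derivative_mean.
rewrite -cint_cst -cintD// -cintZ//; apply: le_cint => //.
  by move=> t; apply: cvgM; [exact: cvg_cst|exact: c1].
move=> t; apply: le_trans (powRD_le p0 (nc_ge0 _) (nc_ge0 _)).
apply: ge0_ler_powR; rewrite ?nnegrE ?addr_ge0 ?nc_ge0 ?ncB// ltW//.
Qed.

(** The tangent of [s `^ (p / 2)] at [|f z|^2], taken at [s = |f w|^2], leaves after
integration a positive multiple of the mean of [|f w - f z|^2].  Equality in the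
sub-mean value property makes this mean vanish. *)
Lemma nc_mean_pow_eq p z r : 2 <= p -> 0 < r -> r < complex.Im z ->
  cint (fun t => nc (f (circ z r t)) `^ p) <= 2 * pi * nc (f z) `^ p ->
  forall t : R, 0 < t < 2 * pi -> f (circ z r t) = f z.
Proof.
move=> p2 r0 rz H; have p0 : 0 < p by lra.
have cp0 : continuous (fun t => nc (f (circ z r t)) `^ p).
  by move=> t; apply: continuous_powR => //; [move=> s; exact: nc_ge0|exact: continuous_nc_circ0].
have [fz0|fz0] := eqVneq (nc (f z)) 0.
  have {}H : cint (fun t => nc (f (circ z r t)) `^ p) <= 0.
    by move: H; rewrite fz0 powR0 ?gt_eqF// mulr0.
  move=> t tpi; have := cint_eq0 cp0 (fun s => powR_ge0 _ _) H tpi.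
  move/powR_eq0_eq0/Normc.eq0_normc => ->.
  by rewrite (Normc.eq0_normc fz0).
have {}fz0 : 0 < nc (f z) by rewrite lt0r fz0 nc_ge0.
pose s0 := nc (f z) ^+ 2; pose q := p / 2.
have s00 : 0 < s0 by rewrite exprn_gt0.
have q1 : 1 <= q by rewrite /q; lra.
have powE w : nc w `^ p = (nc w ^+ 2) `^ q.
  by rewrite -powR_mulrn ?nc_ge0// -powRrM /q mulrCA divff ?mulr1// pnatr_eq0.
pose k := q * s0 `^ (q - 1).
have k0 : 0 < k by rewrite mulr_gt0 ?powR_gt0//; lra.
pose v t := nc (f (circ z r t) - f z) ^+ 2.
pose l t := complex.Re (conjc (f z) * f (circ z r t)).
have cv : continuous v.
  by move=> t; apply: cvgM; exact: continuous_nc_circ.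
have cl : continuous l.
  move=> t; apply: ccont_Re; apply: ccontM; first exact: ccont_cst.
  exact: ccont_circ fd _ _ _ _ _.
have El : cint l = 2 * pi * s0 by rewrite /l (mean_value fd r0 rz) conj_mul_nc.
have lin : cint (fun t => (s0 `^ q - 2 * k * s0) + (2 * k * l t + k * v t)) =
    2 * pi * s0 `^ q + k * cint v.
  have c1 : continuous (fun t => 2 * k * l t).
    by move=> t; apply: cvgM; [exact: cvg_cst|exact: cl].
  have c2 : continuous (fun t => k * v t).
    by move=> t; apply: cvgM; [exact: cvg_cst|exact: cv].
  rewrite cintD; [|by move=> t; exact: cvg_cst|by move=> t; apply: cvgD; [exact: c1|exact: c2]].
  by rewrite cint_cst cintD// !cintZ// El; ring.
have : cint (fun t => (s0 `^ q - 2 * k * s0) + (2 * k * l t + k * v t)) <=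
    cint (fun t => nc (f (circ z r t)) `^ p).
  apply: le_cint => //.
    move=> t; apply: cvgD; first exact: cvg_cst.
    by apply: cvgD; (apply: cvgM; first exact: cvg_cst); [exact: cl|exact: cv].
  move=> t; rewrite powE.
  apply: le_trans (powR_tangent q1 (sqr_ge0 _) s00).
  rewrite (nc_sqr_expand (f z) (f (circ z r t))) -/s0 -/(l t) -/(v t) -/k.
  by rewrite le_eqVlt; apply/orP; left; apply/eqP; ring.
rewrite lin powE -/s0 in H * => H'.
have iv : cint v <= 0 by rewrite -(pmulr_rle0 _ k0); lra.
move=> t tpi; have := cint_eq0 cv (fun t => sqr_ge0 _) iv tpi.
move=> /eqP; rewrite sqrf_eq0 => /eqP/Normc.eq0_normc/eqP.
by rewrite subr_eq0 => /eqP.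
Qed.

End HolomorphicEstimates.

Section DerivativeContinuity.
Context {R : realType}.
Variables (f f' : R[i] -> R[i]).
Hypothesis fd : forall z, 0 < complex.Im z -> cdiff f z (f' z).
Local Notation nc := (@Normc.normc R).

(** With [d = f' z], the function [f w - d * w] varies by [o(|w - z|)] near [z],
so Cauchy's estimate on circles of radius [|w|] centred at [z + w] makes its
derivative [f' (z + w) - d] small. *)
Lemma derivative_continuous z : 0 < complex.Im z -> forall e : R, 0 < e ->
  exists2 del : R, 0 < del & forall w : R[i], nc w <= del -> nc (f' (z + w) - f' z) <= e.
Proof.
move=> z0 e e0; set d := f' z.
have e30 : 0 < e / 3 by rewrite divr_gt0.
have [del del0 H] := fd z0 e30; rewrite -/d in H.
have m0 : 0 < Num.min (del / 2) (complex.Im z / 3) by rewrite lt_min !divr_gt0.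
exists (Num.min (del / 2) (complex.Im z / 3)) => // w.
rewrite le_min => /andP[wd wz].
have [->|w0] := eqVneq w 0; first by rewrite addr0 subrr nc0 ltW.
have {}w0 : 0 < nc w.
  by rewrite lt0r nc_ge0 andbT; apply: contra_neq w0; exact: Normc.eq0_normc.
(* Subtracting the tangent map turns the claim into smallness of a derivative. *)
pose F x := f x - d * x.
have Fd x : 0 < complex.Im x -> cdiff F x (f' x - d).
  move=> x0; have := cdiff_add (fd x0) (cdiff_lin (- d) x).
  by under [X in cdiff X]eq_fun do rewrite mulNr.
have z1 : nc w < complex.Im (z + w).
  have ImD (a b : R[i]) : complex.Im (a + b) = complex.Im a + complex.Im b.
    by case: a; case: b.
  by have := Im_le_nc w; rewrite ler_norml ImD => /andP[+ _]; lra.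
have := nc_derivative_mean Fd w0 z1.
have FE x : F (z + x) - F z = f (z + x) - f z - d * x by rewrite /F; ring.
have bnd t : nc (F (circ (z + w) (nc w) t) - F (z + w)) <= e * nc w.
  pose x := circ (z + w) (nc w) t - (z + w).
  have xw : nc x = nc w by rewrite /x nc_circ ?nc_ge0.
  have -> : circ (z + w) (nc w) t = z + (w + x) by rewrite /x; ring.
  have -> : F (z + (w + x)) - F (z + w) = (F (z + (w + x)) - F z) - (F (z + w) - F z) by ring.
  have wx := ncD w x.
  apply: le_trans (ncB _ _) _; rewrite !FE.
  have h1 : nc (w + x) <= del by lra.
  have h2 : nc w <= del by lra.
  have := H _ h1; have := H _ h2.
  have : e / 3 * nc (w + x) <= e / 3 * (2 * nc w) by rewrite ler_pM2l//; lra.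
  lra.
have : cint (fun t => nc (F (circ (z + w) (nc w) t) - F (z + w))) <= 2 * pi * (e * nc w).
  rewrite -cint_cst; apply: le_cint => //; last by move=> t; exact: cvg_cst.
  exact: continuous_nc_circ Fd _ _ _ _ _.
move=> /[swap] /le_trans /[apply].
by rewrite ler_pM2l ?pi2_gt0// mulrC ler_pM2r.
Qed.

End DerivativeContinuity.

(** * Tonelli's theorem and translation invariance *)

Section MeasureTools.
Context {R : realType}.
Local Notation mu := (@lebesgue_measure R).
Local Notation T := (measurableTypeR R).

(** The image measure agrees with Lebesgue measure on half-open intervals, which determine
a measure finite on them. *)
Lemma lebesgue_measure_shift (c : R) (A : set T) : measurable A ->
  pushforward mu (fun x : T => x + c : T) A = mu A.
Proof.
have mc : measurable_fun setT (fun x : T => x + c : T).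
  exact: measurable_funD.
move=> mA; apply/esym.
pose m := pushforward mu (fun x : T => x + c : T).
apply: (@lebesgue_measure_unique R m) => //= _ [[a b]] _ <-.
rewrite /m /pushforward.
have -> : (fun x : T => x + c) @^-1` `]a, b] = `](a - c), (b - c)]%classic.
  by apply/seteqP; split => x /=; rewrite !in_itv/= ltrBlDr lerBrDr.
rewrite !lebesgue_measure_itv/= !lte_fin ltrD2r; case: ifPn => // _.
by rewrite -!EFinB; congr EFin; ring.
Qed.

Lemma ge0_integral_shift (c : R) (f : T -> \bar R) :
  measurable_fun setT f -> (forall x, (0 <= f x)%E) ->
  (\int[mu]_x f ((x : R) + c)%R)%E = (\int[mu]_x f x)%E.
Proof.
move=> mf f0; pose phi := fun x : T => x + c : T.
have mc : measurable_fun setT phi by exact: measurable_funD.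
transitivity (\int[pushforward mu phi]_x f x)%E.
  by rewrite ge0_integral_pushforward.
by apply: eq_measure_integral => A mA _; exact: lebesgue_measure_shift.
Qed.

(** A function of two variables that is continuous in one and measurable in the
other (a Caratheodory function) is the limit of the functions obtained by
rounding the continuous variable down to a grid, hence jointly measurable. *)
Lemma measurable_fun_caratheodory (F : T -> R -> R) : (forall x, continuous (F x)) ->
  (forall t, measurable_fun setT (F^~ t)) ->
  measurable_fun setT (fun z : T * T => F z.1 z.2).
Proof.
move=> cF mF; pose q (n : nat) (t : R) : R := (Num.floor (t * n.+1%:R))%:~R / n.+1%:R.
have qt n t : q n t <= t < q n t + n.+1%:R^-1.
  have n0 : 0 < n.+1%:R :> R by rewrite ltr0n.
  rewrite /q ler_pdivrMr// floor_le/= -[X in _ + X]mul1r -mulrDl ltr_pdivlMr//.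
  by have := floorD1_gt (t * n.+1%:R); rewrite intrD.
apply: (@measurable_fun_cvg _ _ R setT (fun n (z : T * T) => F z.1 (q n z.2))).
  move=> n _ B mB; rewrite setTI.
  have -> : (fun z : T * T => F z.1 (q n z.2)) @^-1` B =
      \bigcup_(k : int) (((F^~ (k%:~R / n.+1%:R)) @^-1` B) `*`
       [set t : T | (k%:~R <= t * n.+1%:R < k%:~R + 1)]).
    apply/seteqP; split=> [[x t] /= H|[x t] [k _ []]] /=.
      exists (Num.floor (t * n.+1%:R)) => //; split=> //=.
      by rewrite floor_le/=; have := floorD1_gt (t * n.+1%:R); rewrite intrD.
    move=> H /andP[k1 k2]; rewrite /q.
    by have -> : Num.floor (t * n.+1%:R) = k by apply: floor_def; rewrite k1 intrD.
  apply: countable_bigcupT_measurable; first exact: countableP.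
  move=> k; apply: measurableX; first by rewrite -[X in measurable X]setTI; exact: mF.
  have -> : [set t : T | k%:~R <= t * n.+1%:R < k%:~R + 1] =
      `[(k%:~R / n.+1%:R), ((k%:~R + 1) / n.+1%:R)[%classic.
    by apply/seteqP; split => t /=; rewrite in_itv/= ler_pdivrMr ?ltr_pdivlMr ?ltr0n.
  exact: measurable_itv.
move=> [x t] _ /=; apply: (@cvg_comp _ _ _ (q^~ t) (F x) _ (nbhs t)); last exact: cF.
apply/cvgrPdist_le => e e0.
have := near_infty_natSinv_lt (PosNum e0); apply: filterS => n /= ne.
have /andP[q1 q2] := qt n t.
by rewrite ger0_norm ?subr_ge0// lerBlDl; apply: ltW; apply: lt_trans q2 _; rewrite ltrD2l.
Qed.

Section tonelli.
Variables (F : T -> R -> R) (a b : R).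
Hypothesis F0 : forall x t, 0 <= F x t.
Hypothesis mF : measurable_fun setT (fun z : T * T => F z.1 z.2).

Let G : T * T -> \bar R := (fun z : T * T => (F z.1 z.2)%:E) \_ (setT `*` `[a, b]).

Let mG : measurable_fun setT G.
Proof.
apply/measurable_restrict => //; first by apply: measurableX.
by rewrite setTI; apply: measurable_funTS; apply/measurable_EFinP.
Qed.

Let G0 z : (0 <= G z)%E.
Proof. by rewrite /G patchE; case: ifPn => // _; rewrite lee_fin. Qed.

Let GE x : (\int[mu]_(t in `[a, b]) (F x t)%:E = \int[mu]_t G (x, t))%E.
Proof.
rewrite integral_mkcond; apply: eq_integral => t _; rewrite /G !patchE.
congr (if _ then _ else _); apply/idP/idP; rewrite !inE => //.
by move=> [].
Qed.

Lemma tonelli_itv : (\int[mu]_x \int[mu]_(t in `[a, b]) (F x t)%:E =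
  \int[mu]_(t in `[a, b]) \int[mu]_x (F x t)%:E)%E.
Proof.
under eq_integral do rewrite GE.
have := @fubini_tonelli _ _ T T R mu mu G mG G0 => ->.
rewrite [RHS]integral_mkcond; apply: eq_integral => t _; rewrite patchE.
case: ifPn => tab.
  by apply: eq_integral => x _; rewrite /G patchE ifT// inE; split => //; rewrite inE in tab.
rewrite integral0_eq// => x _; rewrite /G patchE ifF//.
by apply/negP => /set_mem[_ /= /mem_set]; apply/negP.
Qed.

(** Part of Tonelli's theorem; it makes circle means measurable in the centre. *)
Lemma measurable_tonelli_itv :
  measurable_fun setT (fun x : T => \int[mu]_(t in `[a, b]) (F x t)%:E)%E.
Proof.
under eq_fun do rewrite GE.
exact: (@measurable_fun_fubini_tonelli_F _ _ T T R mu G mG G0).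
Qed.

End tonelli.

End MeasureTools.

Section TonelliBounds.
Context {R : realType}.
Local Notation mu := (@lebesgue_measure R).
Local Notation T := (measurableTypeR R).

Lemma tonelli_itv_le (F : T -> R -> R) (a b B : R) : a <= b ->
  (forall x t, 0 <= F x t) -> measurable_fun setT (fun z : T * T => F z.1 z.2) ->
  (forall t, a <= t <= b -> (\int[mu]_x (F x t)%:E <= B%:E)%E) ->
  (\int[mu]_x \int[mu]_(t in `[a, b]) (F x t)%:E <= (B * (b - a))%:E)%E.
Proof.
move=> ab F0 mF HB; rewrite tonelli_itv//.
apply: (@le_trans _ _ (\int[mu]_(t in `[a, b]) (cst B%:E) t)%E).
  apply: ge0_le_integral => //.
  - by move=> t _; apply: integral_ge0 => x _; rewrite lee_fin.
  - apply: measurable_funTS.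
    apply: (@measurable_fun_fubini_tonelli_G _ _ T T R mu (fun z => (F z.1 z.2)%:E)).
      exact/measurable_EFinP.
    by move=> z; rewrite lee_fin.
rewrite integral_cst//= lebesgue_measure_itv/= lte_fin.
case: ltP => [_|ba]; first by rewrite -EFinB -EFinM.
have -> : b = a by apply/eqP; rewrite eq_le ab ba.
by rewrite subrr mulr0 mule0.
Qed.

Lemma EFin_Rintegral_itv (v : R -> R) (a b : R) :
  (forall t, a <= t <= b -> {for t, continuous v}) ->
  (\int[mu]_(t in `[a, b]) (v t)%:E)%E = (\int[mu]_(t in `[a, b]) v t)%:E.
Proof.
move=> cv; have iv : mu.-integrable `[a, b] (EFin \o v).
  apply: continuous_compact_integrable; first exact: segment_compact.
  by apply: continuous_in_subspaceT => y; rewrite inE/= in_itv/=; exact: cv.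
have fi : (\int[mu]_(t in `[a, b]) (EFin \o v) t)%E \is a fin_num.
  by apply: integrable_fin_num.
by rewrite /Rintegral fineK.
Qed.

Lemma nonincreasing_of_derive (u : R -> R) (a b : R) : a <= b ->
  (forall s, a <= s <= b -> exists2 l : R, is_derive s (1 : R) u l & l <= 0) ->
  u b <= u a.
Proof.
move=> ab H; have d s : a <= s <= b -> derivable u s 1 /\ u^`() s <= 0.
  by move=> /H[l dl l0]; split; [exact: ex_derive|rewrite derive1E derive_val].
have [||x xab E] := @MVT_segment R u u^`() a b ab.
- move=> x; rewrite in_itv/= => /andP[x1 x2]; rewrite derive1E; apply/derivableP.
  by have [] := d x; rewrite ?(ltW x1) ?(ltW x2).
- apply: derivable_within_continuous => x; rewrite in_itv/= => xab.
  by have [] := d x xab.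
rewrite -subr_le0 E mulr_le0_ge0 ?subr_ge0//.
by move: xab; rewrite in_itv/= => /d[].
Qed.

End TonelliBounds.

(** * Powers of the modulus along horizontal lines *)

Section VerticalDerivative.
Context {R : realType}.
Implicit Types (z w d : R[i]) (p x y : R).
Local Notation nc := (@Normc.normc R).

Lemma cdiff_is_derive_vert (f : R[i] -> R[i]) x y d : cdiff f (x +i* y) d ->
  is_derive y (1 : R) (fun y => complex.Re (f (x +i* y))) (- complex.Im d) /\
  is_derive y (1 : R) (fun y => complex.Im (f (x +i* y))) (complex.Re d).
Proof.
move=> fd.
suff H : forall e : R, 0 < e -> exists2 del : R, 0 < del & forall h : R, `|h| <= del ->
    nc (f (x +i* (y + h)) - f (x +i* y) - d * (0 +i* h)) <= e * `|h|.
  split; apply: eps_is_derive => e e0; have [del del0 {}H] := H e e0; exists del => // h hd;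
    apply: le_trans (H h hd).
    apply: le_trans (Re_le_nc _); rewrite !ReB.
    by rewrite le_eqVlt; apply/orP; left; apply/eqP; congr `|_|; case: (d) => a b /=; ring.
  apply: le_trans (Im_le_nc _); rewrite !ImB.
  by rewrite le_eqVlt; apply/orP; left; apply/eqP; congr `|_|; case: (d) => a b /=; ring.
move=> e e0; have [del del0 H] := fd e e0; exists del => // h hd.
have -> : x +i* (y + h) = (x +i* y) + (0 +i* h) by simpc.
by have := H (0 +i* h); rewrite nc_imag; apply.
Qed.

Lemma powRB1_mul_le (a b p : R) : 1 < p -> 0 <= a -> 0 <= b ->
  a `^ (p - 1) * b <= a `^ p + b `^ p.
Proof.
move=> p1 a0 b0; have p0 : 0 < p by lra.
have p10 : 0 <= p - 1 by lra.
have [ab|ab] := leP a b.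
  apply: (@le_trans _ _ (b `^ (p - 1) * b)).
    by rewrite ler_wpM2r// ge0_ler_powR.
  by rewrite mulrC mulr_powRB1// lerDr powR_ge0.
apply: (@le_trans _ _ (a `^ (p - 1) * a)).
  by rewrite ler_wpM2l ?powR_ge0// ltW.
by rewrite mulrC mulr_powRB1// lerDl powR_ge0.
Qed.

(** Where [f] vanishes, a displacement [h] gives [|f|^p = O(|h|^p)] with [p > 1], so
the derivative exists and is zero there; elsewhere [|f|^p] is a smooth function
of [|f|^2], and its derivative is at most [p * |f|^(p - 1) * |f'|]. *)
Lemma vertical_derivative_pow (f : R[i] -> R[i]) p x y d : 2 <= p ->
  cdiff f (x +i* y) d ->
  exists2 l : R, is_derive y (1 : R) (fun y => nc (f (x +i* y)) `^ p) l &
    `|l| <= p * (nc (f (x +i* y)) `^ p + nc d `^ p).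
Proof.
move=> p2 fd; have p0 : 0 < p by lra.
have p1 : 1 < p by lra.
set w := f (x +i* y).
have bnd0 : 0 <= p * (nc w `^ p + nc d `^ p).
  by rewrite mulr_ge0 ?addr_ge0 ?powR_ge0// ltW.
have [w0|w0] := eqVneq (nc w) 0.
  exists 0; last by rewrite normr0.
  apply: eps_is_derive => e e0; have [del del0 H] := fd 1 ltr01.
  pose C := nc d + 1; have C0 : 0 < C by rewrite ltr_wpDl ?nc_ge0.
  have Cp : 0 < C `^ p by rewrite powR_gt0.
  exists (Num.min del (Num.min 1 (e / C `^ p))).
    by rewrite !lt_min del0 ltr01 divr_gt0.
  move=> h; rewrite !le_min => /and3P[h1 h2 h3].
  rewrite -/w w0 powR0 ?gt_eqF// mul0r !subr0 ger0_norm ?powR_ge0//.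
  have fw : f (x +i* y) = 0 := Normc.eq0_normc w0.
  have := H (0 +i* h); rewrite nc_imag => /(_ h1); rewrite fw subr0 mul1r.
  have -> : (x +i* y) + (0 +i* h) = x +i* (y + h) by simpc.
  move=> k1; have k2 : nc (f (x +i* (y + h))) <= C * `|h|.
    have -> : f (x +i* (y + h)) = (f (x +i* (y + h)) - d * (0 +i* h)) + d * (0 +i* h).
      by rewrite subrK.
    by apply: le_trans (ncD _ _) _; rewrite ncM nc_imag /C mulrDl mul1r addrC lerD2l.
  apply: (@le_trans _ _ ((C * `|h|) `^ p)).
    by rewrite ge0_ler_powR ?nnegrE ?nc_ge0 ?mulr_ge0// ltW.
  rewrite powRM ?(ltW C0)//.
  have hp : `|h| `^ p <= `|h| * `|h|.
    have [->|h0] := eqVneq h 0; first by rewrite normr0 powR0 ?gt_eqF// mul0r.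
    rewrite -expr2 -powR_mulrn//; apply: ger_powR => //.
    by rewrite normr_gt0 h0.
  apply: (le_trans (ler_wpM2l (ltW Cp) hp)).
  by rewrite mulrA ler_wpM2r// mulrC -ler_pdivlMr.
have {}w0 : 0 < nc w by rewrite lt0r w0 nc_ge0.
pose N y := complex.Re (f (x +i* y)) ^+ 2 + complex.Im (f (x +i* y)) ^+ 2.
have NE s : nc (f (x +i* s)) `^ p = N s `^ (p / 2).
  by rewrite /N -nc_sqr -powR_mulrn ?nc_ge0// -powRrM mulrCA divff ?mulr1//.
have N0 : 0 < N y by rewrite /N -nc_sqr exprn_gt0.
have [dre dim] := cdiff_is_derive_vert fd.
pose N' := 2 * (complex.Re w * - complex.Im d + complex.Im w * complex.Re d).
have dN : is_derive y (1 : R) N N'.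
  have -> : N = (fun y => complex.Re (f (x +i* y))) * (fun y => complex.Re (f (x +i* y)))
      + (fun y => complex.Im (f (x +i* y))) * (fun y => complex.Im (f (x +i* y))).
    by apply/funext => s; rewrite /N !expr2.
  have dN' := is_deriveD (is_deriveM dre dre) (is_deriveM dim dim).
  by apply: (is_derive_eq dN'); rewrite /N' -/w /GRing.scale/=; ring.
have dU := is_derive1_comp (is_derive1_powR (p / 2) N0) dN.
exists (p / 2 * N y `^ (p / 2 - 1) * N').
  by under eq_fun do rewrite NE.
have N'b : `|N'| <= 2 * (nc w * nc d).
  rewrite /N' normrM ger0_norm// ler_pM2l// -ncM.
  have -> : complex.Re w * - complex.Im d + complex.Im w * complex.Re d =
    complex.Re ((conjc w) * (d * 'i)).
    by case: (w) => a b; case: (d) => a' b' /=; ring.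
  by apply: le_trans (Re_le_nc _) _; rewrite !ncM nc_conj nci mulr1.
have NyE : N y `^ (p / 2 - 1) * nc w = nc w `^ (p - 1).
  rewrite /N -nc_sqr -powR_mulrn ?nc_ge0// -powRrM.
  rewrite -{2}[nc w]powRr1 ?nc_ge0// -powRD; last by rewrite (gt_eqF w0) implybT.
  by congr (_ `^ _); field.
have k0 : 0 <= p / 2 * N y `^ (p / 2 - 1) by rewrite mulr_ge0 ?powR_ge0 ?divr_ge0// ltW.
rewrite normrM (ger0_norm k0); apply: le_trans (ler_wpM2l k0 N'b) _.
have -> : p / 2 * N y `^ (p / 2 - 1) * (2 * (nc w * nc d)) =
  p * (N y `^ (p / 2 - 1) * nc w * nc d) by field.
by rewrite NyE ler_pM2l// powRB1_mul_le ?nc_ge0.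
Qed.

End VerticalDerivative.

Section PowerOnLines.
Context {R : realType}.
Implicit Types (z w d : R[i]) (p x y r : R).
Local Notation nc := (@Normc.normc R).
Local Notation mu := (@lebesgue_measure R).
Local Notation T := (measurableTypeR R).

Definition line_pow (f : R[i] -> R[i]) p x y := nc (f (x +i* y)) `^ p.

Variables (f f' : R[i] -> R[i]) (p : R).
Hypothesis fd : forall z, 0 < complex.Im z -> cdiff f z (f' z).
Hypothesis p2 : 2 <= p.
Let U := line_pow f p.
Let V := line_pow f' p.

Let p0 : 0 < p. Proof. by move: p2 => ?; lra. Qed.
Let p1 : 1 <= p. Proof. by move: p2 => ?; lra. Qed.

Lemma line_pow_ge0 g x y : 0 <= line_pow g p x y.
Proof. exact: powR_ge0. Qed.

Lemma continuous_line_pow_h y : 0 < y -> continuous (fun x => U x y).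
Proof.
move=> y0 x; apply: continuous_powR => //; first by move=> s; exact: nc_ge0.
by apply: ccont_nc; apply: ccont_horiz; exact: (@fd (x +i* y)).
Qed.

Lemma continuous_line_pow_v x y : 0 < y -> {for y, continuous (U x)}.
Proof.
move=> y0; apply: continuous_powR => //; first by move=> s; exact: nc_ge0.
by apply: ccont_nc; apply: ccont_vert; exact: (@fd (x +i* y)).
Qed.

Lemma continuous_derivative_pow_h y : 0 < y -> continuous (fun x => V x y).
Proof.
move=> y0 x; apply: continuous_powR => //; first by move=> s; exact: nc_ge0.
apply: ccont_nc => e e0.
have [del del0 H] := @derivative_continuous _ _ _ fd (x +i* y) y0 e e0.
exists del => // h hd; have -> : (x + h) +i* y = (x +i* y) + h%:C.
  by rewrite /real_complex_def; simpc.
by apply: H; rewrite nc_real.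
Qed.

Lemma continuous_derivative_pow_v x y : 0 < y -> {for y, continuous (V x)}.
Proof.
move=> y0; apply: continuous_powR => //; first by move=> s; exact: nc_ge0.
apply: ccont_nc => e e0.
have [del del0 H] := @derivative_continuous _ _ _ fd (x +i* y) y0 e e0.
exists del => // h hd; have -> : x +i* (y + h) = (x +i* y) + (0 +i* h) by simpc.
by apply: H; rewrite nc_imag.
Qed.

Lemma measurable_line_pow y : 0 < y -> measurable_fun setT (fun x : T => U x y).
Proof. by move=> y0; apply: continuous_measurable_fun; exact: continuous_line_pow_h. Qed.

Lemma measurable_derivative_pow y : 0 < y -> measurable_fun setT (fun x : T => V x y).
Proof.
by move=> y0; apply: continuous_measurable_fun; exact: continuous_derivative_pow_h.
Qed.

Definition circle_pow r y (x : T) (t : R) : R := U (x + r * cos t) (y + r * sin t).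

Lemma circle_height r y t : 0 < r -> r < y -> 0 < y + r * sin t.
Proof. by move=> r0 ry; have := @Im_circ_gt0 R (0 +i* y) r t (ltW r0) ry. Qed.

Lemma continuous_circle_pow r y x : 0 < r -> r < y -> continuous (circle_pow r y x).
Proof.
move=> r0 ry t; apply: continuous_powR => //; first by move=> s; exact: nc_ge0.
exact: (continuous_nc_circ0 fd (z := x +i* y)).
Qed.

Lemma measurable_circle_pow r y : 0 < r -> r < y ->
  measurable_fun setT (fun z : T * T => circle_pow r y z.1 z.2).
Proof.
move=> r0 ry; apply: (@measurable_fun_caratheodory R (circle_pow r y)).
  by move=> x; exact: continuous_circle_pow.
move=> t; rewrite /circle_pow.
have mU := measurable_line_pow (circle_height t r0 ry).
by apply: (measurableT_comp mU); exact: measurable_funD.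
Qed.

(** On a fixed angle the circles centred on a horizontal line trace the horizontal
line at height [y + r sin t]. *)
Lemma integral_circle_shift r y t : 0 < r -> r < y ->
  (\int[mu]_x (circle_pow r y x t)%:E = \int[mu]_x (U x (y + r * sin t))%:E)%E.
Proof.
move=> r0 ry; have mU := measurable_line_pow (circle_height t r0 ry).
apply: (@ge0_integral_shift _ (r * cos t) (fun x : T => (U x (y + r * sin t))%:E)).
  exact/measurable_EFinP.
by move=> x; rewrite lee_fin; exact: line_pow_ge0.
Qed.

Lemma EFin_cint_circle r y x : 0 < r -> r < y ->
  (cint (circle_pow r y x))%:E = (\int[mu]_(t in `[0%R, (2 * pi)%R]) (circle_pow r y x t)%:E)%E.
Proof.
by move=> r0 ry; rewrite EFin_Rintegral_itv// => t _; exact: continuous_circle_pow.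
Qed.

Lemma integral_circle_le r y B : 0 < r -> r < y ->
  (forall s, 0 < s -> (\int[mu]_x (U x s)%:E <= B%:E)%E) ->
  (\int[mu]_x (cint (circle_pow r y x))%:E <= (B * (2 * pi))%:E)%E.
Proof.
move=> r0 ry HB; under eq_integral do rewrite EFin_cint_circle//.
rewrite -[X in (B * X)%R]subr0; apply: tonelli_itv_le.
- exact/ltW/pi2_gt0.
- by move=> x t; exact: line_pow_ge0.
- exact: measurable_circle_pow.
- by move=> t _; rewrite integral_circle_shift//; apply: HB; exact: circle_height.
Qed.

(** Cauchy's estimate for [|f'|^p] on a circle of radius [r]. *)
Lemma derivative_pow_le r y x : 0 < r -> r < y ->
  V x y <= 2 `^ p / (2 * pi * r `^ p) * (cint (circle_pow r y x) + 2 * pi * U x y).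
Proof.
move=> r0 ry; have := @derivative_pow_mean _ _ _ fd p (x +i* y) r p1 r0 ry.
rewrite powRM ?nc_ge0 ?(ltW r0)// -/(U x y) -/(V x y) mulrA => H.
have k0 : 0 < 2 * pi * r `^ p by rewrite mulr_gt0 ?pi2_gt0 ?powR_gt0.
by rewrite mulrAC ler_pdivlMr// mulrC.
Qed.

Lemma measurable_cint_circle_pow r y : 0 < r -> r < y ->
  measurable_fun setT (fun x : T => (cint (circle_pow r y x))%:E).
Proof.
move=> r0 ry; have := @measurable_tonelli_itv R (circle_pow r y) 0 (2 * pi)
  (fun x t => line_pow_ge0 f _ _) (measurable_circle_pow r0 ry).
by apply: eq_measurable_fun => x _; rewrite EFin_cint_circle.
Qed.

Lemma integral_derivative_pow_le r B : 0 < r -> 0 <= B ->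
  (forall s, 0 < s -> (\int[mu]_x (U x s)%:E <= B%:E)%E) ->
  exists2 B' : R, 0 <= B' & forall y, r < y -> (\int[mu]_x (V x y)%:E <= B'%:E)%E.
Proof.
move=> r0 B0 HB; pose k := 2 `^ p / (2 * pi * r `^ p).
have k0 : 0 <= k by rewrite divr_ge0 ?mulr_ge0 ?powR_ge0 ?ltW ?pi_gt0.
have p20 := @pi2_gt0 R.
exists (k * (B * (2 * pi) + 2 * pi * B)).
  by apply: mulr_ge0 => //; apply: addr_ge0; apply: mulr_ge0 => //; exact: ltW.
move=> y ry; have y0 : 0 < y := lt_trans r0 ry.
have m1 := measurable_cint_circle_pow r0 ry.
have m2 : measurable_fun setT (fun x : T => ((2 * pi)%:E * (U x y)%:E)%E).
  by apply: measurable_funeM; apply/measurable_EFinP; exact: measurable_line_pow.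
have c0 (x : T) : (0 <= (cint (circle_pow r y x))%:E)%E.
  by rewrite lee_fin; apply: Rintegral_ge0 => t _; exact: line_pow_ge0.
have u0 (x : T) : (0 <= (2 * pi)%:E * (U x y)%:E)%E.
  by rewrite mule_ge0// lee_fin ?line_pow_ge0// ltW.
apply: (@le_trans _ _ (\int[mu]_x (k%:E * ((cint (circle_pow r y x))%:E +
    (2 * pi)%:E * (U x y)%:E)))%E).
  apply: ge0_le_integral => //.
  - by move=> x _; rewrite lee_fin; exact: line_pow_ge0.
  - by apply/measurable_EFinP; exact: measurable_derivative_pow.
  - by apply: measurable_funeM; exact: emeasurable_funD.
  - by move=> x _; have := derivative_pow_le x r0 ry; rewrite -lee_fin EFinM EFinD EFinM.
rewrite ge0_integralZl_EFin//; last 2 first.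
- by move=> x _; exact: adde_ge0 (c0 x) (u0 x).
- exact: emeasurable_funD.
rewrite ge0_integralD// ge0_integralZl_EFin//; last 3 first.
- by move=> x _; rewrite lee_fin; exact: line_pow_ge0.
- by apply/measurable_EFinP; exact: measurable_line_pow.
- exact: ltW.
rewrite [X in (_ <= X)%E]EFinM; apply: lee_pmul => //.
- by rewrite adde_ge0 ?integral_ge0// mule_ge0 ?lee_fin ?(ltW p20)// integral_ge0// => x _; rewrite lee_fin; exact: line_pow_ge0.
rewrite EFinD; apply: leeD; first exact: integral_circle_le.
by rewrite [X in (_ <= X)%E]EFinM lee_pmul2l//; exact: HB.
Qed.

End PowerOnLines.

(** * Domination, and differentiability of the line means *)

Section Domination.
Context {R : realType}.
Implicit Types (z w d : R[i]) (x y r a b c : R).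
Local Notation nc := (@Normc.normc R).
Local Notation mu := (@lebesgue_measure R).
Local Notation T := (measurableTypeR R).

Variables (f f' : R[i] -> R[i]) (p B : R).
Hypothesis fd : forall z, 0 < complex.Im z -> cdiff f z (f' z).
Hypothesis p2 : 2 <= p.
Hypothesis B0 : 0 <= B.
Hypothesis HB : forall s, 0 < s -> (\int[mu]_x (line_pow f p x s)%:E <= B%:E)%E.
Let U := line_pow f p.
Let V := line_pow f' p.
Let W x s : R := U x s + V x s.

Let p0 : 0 < p. Proof. by move: p2 => ?; lra. Qed.

Let W0 x s : 0 <= W x s.
Proof. by rewrite addr_ge0// line_pow_ge0. Qed.

Let cW x s : 0 < s -> {for s, continuous (W x)}.
Proof.
move=> s0; apply: cvgD; first exact: (continuous_line_pow_v fd p2).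
exact: (continuous_derivative_pow_v fd p2).
Qed.

Let mW s : 0 < s -> measurable_fun setT (fun x : T => W x s).
Proof.
move=> s0; apply: measurable_funD; first exact: (measurable_line_pow fd p2).
exact: (measurable_derivative_pow fd p2).
Qed.

Let vint c b x : R := \int[mu]_(s in `[c, b]) W x s.

Let vint0 c b x : 0 <= vint c b x.
Proof. by apply: Rintegral_ge0 => s _; exact: W0. Qed.

(** Since [U' <= p * (U + V)], the function [U - p * \int_c (U + V)] is nonincreasing
in the height.  The integral starts at [c < a] because its derivative in the
upper bound is then two-sided at [a]. *)
Lemma vertical_growth c a b x y : 0 < c -> c < a -> a <= y <= b ->
  U x y <= U x a + p * vint c b x.
Proof.
move=> c0 ca /andP[ay yb].
have dPhi s : a <= s -> is_derive s (1 : R) (fun s => vint c s x) (W x s).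
  move=> as_; apply: (@continuous_primitive R (W x) c s (s + 1)); [lra|lra|].
  by move=> u /andP[u1 _]; apply: cW; lra.
have h1 : U x y - p * vint c y x <= U x a - p * vint c a x.
  apply: (@nonincreasing_of_derive R (fun s => U x s - p * vint c s x)) => //.
  move=> s /andP[as_ sy]; have s0 : 0 < s by lra.
  have [l dl lb] := @vertical_derivative_pow R f p x s _ p2 (fd (z := x +i* s) s0).
  exists (l - p * W x s).
    exact: is_deriveB dl (is_deriveZ p (dPhi s as_)).
  by rewrite subr_le0; apply: le_trans (ler_norm _) _; exact: lb.
have h2 : - vint c b x <= - vint c y x.
  apply: (@nonincreasing_of_derive R (fun s => - vint c s x)) => //.
  move=> s /andP[ys sb]; exists (- W x s); last by rewrite oppr_le0.
  by apply: is_deriveN; apply: dPhi; lra.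
have h3 : p * vint c y x <= p * vint c b x by rewrite ler_pM2l//; lra.
have h4 : 0 <= p * vint c a x by rewrite mulr_ge0// ltW.
lra.
Qed.

(** The integrand is only under control at positive heights; replacing [s] by
[max s c] extends it to a function continuous in [s] on the whole line without
changing it on [[c, b]]. *)
Lemma measurable_vint c b : 0 < c -> measurable_fun setT (fun x : T => vint c b x) /\
  forall B' : R, (forall s, c <= s -> (\int[mu]_x (W x s)%:E <= B'%:E)%E) -> c <= b ->
  (\int[mu]_x (vint c b x)%:E <= (B' * (b - c))%:E)%E.
Proof.
move=> c0; pose F (x : T) (s : R) : R := W x (Num.max s c).
have F0 x s : 0 <= F x s by exact: W0.
have max0 s : 0 < Num.max s c by rewrite lt_max c0 orbT.
have mF : measurable_fun setT (fun z : T * T => F z.1 z.2).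
  apply: (@measurable_fun_caratheodory R F); last by move=> s; exact: mW.
  move=> x s; apply: (@continuous_comp _ _ _ (fun s => Num.max s c) (W x)); last exact: cW.
  by apply: continuous_max; [exact: cvg_id|exact: cvg_cst].
have E x : (vint c b x)%:E = (\int[mu]_(s in `[c, b]) (F x s)%:E)%E.
  rewrite -EFin_Rintegral_itv; last by move=> s /andP[cs _]; apply: cW; lra.
  apply: eq_integral => s; rewrite inE/= in_itv/= => /andP[cs _].
  by rewrite /F (max_idPl cs).
split.
  apply/measurable_EFinP; apply: eq_measurable_fun (measurable_tonelli_itv c b F0 mF).
  by move=> x _ /=; rewrite E.
move=> B' HB' cb; under eq_integral do rewrite E.
apply: tonelli_itv_le => // s /andP[cs _]; rewrite /F (max_idPl cs); exact: HB'.
Qed.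

Lemma integral_W_le c : 0 < c ->
  exists2 B' : R, 0 <= B' & forall s, c <= s -> (\int[mu]_x (W x s)%:E <= B'%:E)%E.
Proof.
move=> c0; have c20 : 0 < c / 2 by rewrite divr_gt0.
have [B' B'0 H] := integral_derivative_pow_le fd p2 c20 B0 HB.
exists (B + B'); first exact: addr_ge0.
move=> s cs; have s0 : 0 < s by lra.
under eq_integral do rewrite EFinD.
rewrite ge0_integralD//.
- by rewrite EFinD; apply: leeD; [exact: HB|apply: H; lra].
- by move=> x _; rewrite lee_fin line_pow_ge0.
- by apply/measurable_EFinP; exact: (measurable_line_pow fd p2).
- by move=> x _; rewrite lee_fin line_pow_ge0.
- by apply/measurable_EFinP; exact: (measurable_derivative_pow fd p2).
Qed.

Lemma ge0_integrable (G : T -> R) (C : R) : measurable_fun setT G -> (forall x, 0 <= G x) ->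
  (\int[mu]_x (G x)%:E <= C%:E)%E -> mu.-integrable setT (EFin \o G).
Proof.
move=> mG G0 H; apply/integrableP; split; first exact/measurable_EFinP.
under eq_integral do rewrite gee0_abs ?lee_fin//.
by apply: le_lt_trans H _; rewrite ltry.
Qed.

(** The majorant is that of [vertical_growth], integrable by Tonelli's theorem and
the bounds on the line integrals of [|f|^p] and [|f'|^p]. *)
Lemma line_pow_dominated a b : 0 < a -> a <= b -> exists G : T -> R,
  [/\ measurable_fun setT G, forall x, 0 <= G x,
      exists C : R, (\int[mu]_x (G x)%:E <= C%:E)%E &
      forall x y, a <= y <= b -> U x y <= G x].
Proof.
move=> a0 ab; have c0 : 0 < a / 2 by rewrite divr_gt0.
have ca : a / 2 < a by lra.
have [mv iv] := measurable_vint b c0.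
have [B' B'0 HB'] := integral_W_le c0.
have mU : measurable_fun setT (fun x : T => U x a) := measurable_line_pow fd p2 a0.
exists (fun x => U x a + p * vint (a / 2) b x); split.
- by apply: measurable_funD => //; apply: measurable_funM.
- by move=> x; rewrite addr_ge0 ?line_pow_ge0// mulr_ge0// ltW.
- exists (B + p * (B' * (b - a / 2))).
  under eq_integral do rewrite EFinD EFinM.
  rewrite ge0_integralD//; last 4 first.
  + by move=> x _; rewrite lee_fin line_pow_ge0.
  + exact/measurable_EFinP.
  + by move=> x _; rewrite -EFinM lee_fin mulr_ge0// ltW.
  + by apply: measurable_funeM; exact/measurable_EFinP.
  rewrite ge0_integralZl_EFin//; last 3 first.
  + by move=> x _; rewrite lee_fin.
  + exact/measurable_EFinP.
  + exact: ltW.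
  rewrite EFinD; apply: leeD; first exact: HB.
  by rewrite [X in (_ <= X)%E]EFinM lee_pmul2l//; apply: iv => //; lra.
- by move=> x y yab; exact: vertical_growth.
Qed.

End Domination.

Section DerivabilityOfMean.
Context {R : realType}.
Implicit Types (z w d : R[i]) (x y r a b c : R).
Local Notation nc := (@Normc.normc R).
Local Notation mu := (@lebesgue_measure R).
Local Notation T := (measurableTypeR R).

Variables (f f' : R[i] -> R[i]) (p B : R).
Hypothesis fd : forall z, 0 < complex.Im z -> cdiff f z (f' z).
Hypothesis p2 : 2 <= p.
Hypothesis B0 : 0 <= B.
Hypothesis HB : forall s, 0 < s -> (\int[mu]_x (line_pow f p x s)%:E <= B%:E)%E.
Let U := line_pow f p.
Let V := line_pow f' p.

Let p0 : 0 < p. Proof. by move: p2 => ?; lra. Qed.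

(** Cauchy's estimate bounds [|f'|^p] at [x + i y] by a mean of [|f|^p] over a circle
of fixed radius, and that by the mean of the majorant of [|f|^p] over the
horizontal projection of the circle.  This last mean, integrable in [x], may be
infinite on a null set, which has to be left out. *)
Lemma derivative_dominated a b : 0 < a -> a <= b -> exists (N : set T) (G : T -> R),
  [/\ measurable N, mu N = 0%E, forall x, 0 <= G x,
      mu.-integrable setT (EFin \o G) &
      forall x y, ~ N x -> a <= y <= b -> U x y + V x y <= G x].
Proof.
move=> a0 ab; pose r := a / 2.
have r0 : 0 < r by rewrite divr_gt0.
have rb : r <= b + r by rewrite /r; lra.
have [G [mG G0 [C HC] GU]] := line_pow_dominated fd p2 B0 HB r0 rb.
have p20 := @pi2_gt0 R.
pose F (x : T) (t : R) : R := G (x + r * cos t).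
have F0 x t : 0 <= F x t by exact: G0.
have mF : measurable_fun setT (fun z : T * T => F z.1 z.2).
  apply: (measurableT_comp mG).
  apply: (@measurable_funD _ _ R setT (fun z : T * T => z.1) (fun z : T * T => r * cos z.2)).
    exact: measurable_fst.
  have mc : measurable_fun setT (fun t : T => r * cos t : R).
    apply: continuous_measurable_fun => t; apply: cvgM; first exact: cvg_cst.
    exact: continuous_cos.
  by apply: (measurableT_comp mc); exact: measurable_snd.
pose I (x : T) : \bar R := (\int[mu]_(t in `[0%R, (2 * pi)%R]) (F x t)%:E)%E.
have I0 x : (0 <= I x)%E by apply: integral_ge0 => t _; rewrite lee_fin.
have mI : measurable_fun setT I := measurable_tonelli_itv 0 (2 * pi) F0 mF.
have iI : (\int[mu]_x I x <= (C * (2 * pi))%:E)%E.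
  rewrite -[X in (C * X)%R]subr0; apply: tonelli_itv_le => //; first exact: ltW.
  move=> t _; apply: le_trans HC.
  have := @ge0_integral_shift R (r * cos t) (fun x => (G x)%:E).
  by rewrite /F => -> //; exact/measurable_EFinP.
have intI : mu.-integrable setT I.
  apply/integrableP; split => //; under eq_integral do rewrite gee0_abs//.
  by apply: le_lt_trans iI _; rewrite ltry.
have [N [mN N0 IN]] := integrable_ae measurableT intI.
have IfinE x : ~ N x -> (fine (I x))%:E = I x.
  by move=> Nx; rewrite fineK//; apply: contrapT => H; apply: Nx; apply: IN => /(_ Logic.I).
pose k := 2 `^ p / (2 * pi * r `^ p).
have k0 : 0 <= k by rewrite divr_ge0 ?mulr_ge0 ?powR_ge0 ?ltW ?pi_gt0.
have fI0 x : 0 <= fine (I x) by rewrite fine_ge0.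
have iG : mu.-integrable setT (EFin \o G) := ge0_integrable mG G0 HC.
have ifI : mu.-integrable setT (EFin \o (fun x => fine (I x))).
  apply: le_integrable intI => //.
    by apply/measurable_EFinP; apply: (measurableT_comp _ mI); exact: fine_measurable.
  move=> x _ /=; rewrite ger0_norm// gee0_abs//.
  by case: (I x) (I0 x) => [s _|_|] //=; rewrite leey.
exists N, (fun x => G x + k * (fine (I x) + 2 * pi * G x)); split => //.
- by move=> x; rewrite addr_ge0// mulr_ge0// addr_ge0// mulr_ge0// ltW.
- have i1 : mu.-integrable setT (fun x => (2 * pi)%:E * (EFin \o G) x)%E.
    exact: integrableZl.
  have i2 := integrableZl measurableT k (integrableD measurableT ifI i1).
  by have i3 := integrableD measurableT iG i2; apply: eq_integrable i3.
- move=> x y Nx /andP[ay yb]; have ry : r < y by rewrite /r; lra.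
  apply: lerD; first by apply: GU; rewrite /r; lra.
  apply: le_trans (derivative_pow_le fd p2 x r0 ry) _; rewrite ler_wpM2l//.
  have Gx : U x y <= G x by apply: GU; rewrite /r; lra.
  apply: lerD; last by rewrite ler_pM2l.
  rewrite -lee_fin (EFin_cint_circle fd p2)// IfinE//.
  apply: ge0_le_integral => //.
  + by move=> t _; rewrite lee_fin line_pow_ge0.
  + apply/measurable_EFinP; apply: measurable_funTS; apply: continuous_measurable_fun.
    exact: (continuous_circle_pow fd p2).
  + apply: measurable_funTS; apply/measurable_EFinP.
    apply: (measurableT_comp mG); apply: measurable_funD => //.
    apply: continuous_measurable_fun => t; apply: cvgM; first exact: cvg_cst.
    exact: continuous_cos.
  + move=> t _; rewrite lee_fin /circle_pow /F; apply: GU.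
    have h1 : r * sin t <= r by rewrite -[leRHS]mulr1 ler_pM2l// sin_le1.
    have h2 : - r <= r * sin t by rewrite -mulrN1 ler_pM2l// sin_geN1.
    by rewrite /r in h1 h2 *; lra.
Qed.

Lemma line_integrable y : 0 < y -> mu.-integrable setT (EFin \o (fun x : T => U x y)).
Proof.
move=> y0; apply: (ge0_integrable (C := B)).
- exact: (measurable_line_pow fd p2).
- by move=> x; exact: line_pow_ge0.
- exact: HB.
Qed.

(** Differentiation under the integral sign on a strip around [y], off the
exceptional null set. *)
Lemma derivable_mean y : 0 < y -> derivable (fun y => \int[mu]_x U x y) y 1.
Proof.
move=> y0; have y20 : 0 < y / 2 by rewrite divr_gt0.
have y2y : y / 2 <= 2 * y by lra.
have [N [G [mN N0 G0 iG GUV]]] := derivative_dominated y20 y2y.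
pose D : set T := setT `\` N.
have mD : measurable D by exact: measurableD.
have pos s : (`]y / 2, 2 * y[%classic : set R) s -> 0 < s /\ y / 2 <= s <= 2 * y.
  by rewrite /= in_itv/= => /andP[s1 s2]; split; lra.
have ID s : 0 < s -> \int[mu]_x U x s = \int[mu]_(x in D) U x s.
  move=> s0; rewrite /Rintegral; congr fine; apply: ge0_negligible_integral => //.
  - by apply/measurable_EFinP; exact: (measurable_line_pow fd p2).
  - by move=> x _; rewrite lee_fin line_pow_ge0.
have der (x s : R) : 0 < s -> exists2 l : R,
    is_derive s (1 : R) (U x) l & `|l| <= p * (U x s + V x s).
  by move=> s0; exact: vertical_derivative_pow p2 (fd (z := x +i* s) s0).
have : derivable (fun s => \int[mu]_(x in D) U x s) y 1.
  apply: (@derivable_under_integral R _ T mu (fun s x => U x s) D mD y (y / 2) (2 * y)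
    _ _ _ (fun x => p * G x)).
  - by rewrite /= in_itv/=; lra.
  - move=> s /pos[s0 _]; apply: integrableS (line_integrable s0) => //.
  - by move=> s x /pos[s0 _] _; have [l dl _] := der x s s0; exact: ex_derive.
  - by move=> x; rewrite mulr_ge0// ltW.
  - apply: (@integrableS _ _ R mu setT) => //.
    by have := integrableZl measurableT p iG; apply: eq_integrable.
  - move=> s x /pos[s0 sI] [_ Nx]; have [l dl lb] := der x s s0.
    rewrite /partial1of2 derive1E derive_val; apply: le_trans lb _.
    by rewrite ler_pM2l//; exact: GUV.
apply: near_eq_derivable => //.
by near=> s; rewrite ID//; near: s; exact: lt_nbhsr.
Unshelve. all: by end_near. Qed.

End DerivabilityOfMean.

(** * Convexity from the sub-mean value property *)

Section SubMeanConvexity.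
Context {R : realType}.
Implicit Types (psi : R -> R) (a b c y r : R).

(** A circle mean of a function of the height alone. *)
Definition vertical_mean psi y r := cint (fun t => psi (y + r * sin t)).

Let height y r t : 0 < r -> r < y -> 0 < y + r * sin t.
Proof. exact: circle_height. Qed.

Lemma continuous_height psi y r : 0 < r -> r < y ->
  (forall s, 0 < s -> {for s, continuous psi}) ->
  continuous (fun t => psi (y + r * sin t)).
Proof.
move=> r0 ry cpsi t; apply: (@continuous_comp _ _ _ (fun t => y + r * sin t) psi).
  apply: cvgD; first exact: cvg_cst.
  by apply: cvgM; [exact: cvg_cst|exact: continuous_sin].
exact/cpsi/height.
Qed.

(** The mean value property of the identity at a point of the half-plane. *)
Lemma cint_sin : cint (@sin R) = 0.
Proof.
have fd (z : R[i]) : 0 < complex.Im z -> cdiff (fun z => 1 * z) z 1 by move=> _; exact: cdiff_lin.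
have := @mean_value R _ _ fd (0 +i* 2) 1 ltr01 _ (0 +i* (-1)).
rewrite ltr1n => /(_ isT).
have -> : (fun t : R => complex.Re ((0 +i* -1) * (1 * circ (0 +i* 2) 1 t))) = (fun t : R => 2 + sin t).
  by apply/funext => t; rewrite /circ /=; ring.
rewrite cintD; [|by move=> t; exact: cvg_cst|exact: continuous_sin].
by rewrite cint_cst /= => H; lra.
Qed.

Lemma vertical_mean_affine (k m y r : R) :
  vertical_mean (fun s => k + m * s) y r = 2 * pi * (k + m * y).
Proof.
rewrite /vertical_mean.
have -> : (fun t : R => k + m * (y + r * sin t)) = (fun t : R => (k + m * y) + m * r * sin t).
  by apply/funext => t; ring.
have c1 : continuous (fun t : R => m * r * sin t).
  by move=> t; apply: cvgM; [exact: cvg_cst|exact: continuous_sin].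
rewrite cintD//; last by move=> t; exact: cvg_cst.
by rewrite cint_cst cintZ ?cint_sin ?mulr0 ?addr0//; exact: continuous_sin.
Qed.

Lemma vertical_mean_sqr y r : 0 < r -> 2 * pi * y ^+ 2 < vertical_mean (fun s => s ^+ 2) y r.
Proof.
move=> r0; rewrite /vertical_mean.
have cs : continuous (fun t : R => sin t ^+ 2).
  by move=> t; apply: cvgM; exact: continuous_sin.
have -> : (fun t : R => (y + r * sin t) ^+ 2) =
    (fun t : R => (y ^+ 2 + 2 * y * r * sin t) + r ^+ 2 * sin t ^+ 2).
  by apply/funext => t; ring.
have c1 : continuous (fun t : R => 2 * y * r * sin t).
  by move=> t; apply: cvgM; [exact: cvg_cst|exact: continuous_sin].
have c2 : continuous (fun t : R => r ^+ 2 * sin t ^+ 2).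
  by move=> t; apply: cvgM; [exact: cvg_cst|exact: cs].
have cc : continuous (fun _ : R => y ^+ 2) by move=> t; exact: cvg_cst.
rewrite cintD//; last by move=> t; apply: cvgD; [exact: cc|exact: c1].
rewrite cintD// cint_cst !cintZ//; last exact: continuous_sin.
rewrite cint_sin mulr0 addr0 ltrDl mulr_gt0 ?exprn_gt0// ltNge; apply/negP => H.
have := @cint_eq0 R _ cs (fun t => sqr_ge0 _) H (pi / 2).
rewrite sin_pihalf expr1n => E; have := pi_gt0 R => pi0.
have h : 0 < (pi / 2 : R) < 2 * pi by apply/andP; split; lra.
by have /eqP := E h; rewrite oner_eq0.
Qed.

(** At an interior maximum of [psi] minus its chord the strict sub-mean value
property would be violated. *)
Lemma strict_convex_of_submean psi : (forall s, 0 < s -> {for s, continuous psi}) ->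
  (forall y r, 0 < r -> r < y -> 2 * pi * psi y < vertical_mean psi y r) ->
  forall a y b, 0 < a -> a < y -> y < b ->
  psi y < psi a + (psi b - psi a) / (b - a) * (y - a).
Proof.
move=> cpsi sub a y b a0 ay yb; have ab : a < b := lt_trans ay yb.
pose m := (psi b - psi a) / (b - a).
pose chi s := psi s + (- (psi a - m * a) + - m * s).
have cchi s : 0 < s -> {for s, continuous chi}.
  move=> s0; apply: cvgD; first exact: cpsi.
  by apply: cvgD; [exact: cvg_cst|apply: cvgM; [exact: cvg_cst|exact: cvg_id]].
have nomax c : a < c < b -> (forall s, a <= s <= b -> chi s <= chi c) -> False.
  move=> /andP[ac cb] cmax; have c0 : 0 < c := lt_trans a0 ac.
  pose r := Num.min (c - a) (b - c) / 2.
  have r0 : 0 < r by rewrite divr_gt0// lt_min !subr_gt0 ac.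
  have rca : r < c - a.
    rewrite ltr_pdivrMr// gt_min; apply/orP; left; lra.
  have rbc : r < b - c.
    rewrite ltr_pdivrMr// gt_min; apply/orP; right; lra.
  have rc : r < c by lra.
  have : vertical_mean chi c r <= 2 * pi * chi c.
    rewrite -cint_cst; apply: le_cint.
    - exact: continuous_height.
    - by move=> t; exact: cvg_cst.
    - move=> t; apply: cmax.
      have h1 : r * sin t <= r by rewrite -[leRHS]mulr1 ler_pM2l// sin_le1.
      have h2 : - r <= r * sin t by rewrite -mulrN1 ler_pM2l// sin_geN1.
      lra.
  have -> : vertical_mean chi c r =
      vertical_mean psi c r + 2 * pi * (- (psi a - m * a) + - m * c).
    rewrite -(vertical_mean_affine _ _ c r) /vertical_mean -cintD//.
      exact: continuous_height.
    apply: (@continuous_height (fun s => - (psi a - m * a) + - m * s)) => // s _.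
    by apply: cvgD; [exact: cvg_cst|apply: cvgM; [exact: cvg_cst|exact: cvg_id]].
  by have := sub c r r0 rc; rewrite /chi mulrDr; lra.
have wchi : {within `[a, b], continuous chi}.
  apply: continuous_in_subspaceT => s; rewrite inE/= in_itv/= => /andP[as_ _].
  exact/cchi/(lt_le_trans a0 as_).
have [c] := @EVT_max R chi a b (ltW ab) wchi.
rewrite in_itv/= => /andP[ac cb] cmax.
have {}cmax s : a <= s <= b -> chi s <= chi c.
  by move=> sab; apply: cmax; rewrite in_itv.
have ba : b - a != 0 by rewrite subr_eq0 gt_eqF.
have chia : chi a = 0 by rewrite /chi; ring.
have chib : chi b = 0 by rewrite /chi /m; field.
have chic : chi c = 0.
  move: ac; rewrite le_eqVlt => /predU1P[<-//|ac].
  move: cb; rewrite le_eqVlt => /predU1P[->//|cb].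
  by exfalso; apply: (nomax c) => //; rewrite ac cb.
have : chi y < 0.
  rewrite ltNge; apply/negP => chiy; apply: (nomax y); first by rewrite ay yb.
  by move=> s sab; apply: le_trans chiy; rewrite -chic; exact: cmax.
by rewrite /chi -/m; lra.
Qed.

(** Adding [d * s^2] makes the sub-mean value inequality strict
([vertical_mean_sqr]) and raises the convexity bound by
[d * (y - a) * (b - y)] only, which is arbitrarily small. *)
Lemma convex_of_submean psi : (forall s, 0 < s -> {for s, continuous psi}) ->
  (forall y r, 0 < r -> r < y -> 2 * pi * psi y <= vertical_mean psi y r) ->
  forall a y b, 0 < a -> a < y -> y < b ->
  psi y <= psi a + (psi b - psi a) / (b - a) * (y - a).
Proof.
move=> cpsi sub a y b a0 ay yb.
apply/ler_addgt0Pr => e e0.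
pose k := (y - a) * (b - y); have k0 : 0 < k by rewrite mulr_gt0 ?subr_gt0.
pose d := e / k; have d0 : 0 < d by rewrite divr_gt0.
have csq : continuous (fun s : R => s ^+ 2) by move=> s; exact: exprn_continuous.
have := @strict_convex_of_submean (fun s => psi s + d * s ^+ 2) _ _ a y b a0 ay yb.
have -> : psi a + d * a ^+ 2 + (psi b + d * b ^+ 2 - (psi a + d * a ^+ 2)) / (b - a) * (y - a) =
   psi a + (psi b - psi a) / (b - a) * (y - a) + (d * y ^+ 2 + d * k).
  by rewrite /k; field; rewrite subr_eq0 gt_eqF// (lt_trans ay).
have -> : d * k = e by rewrite divfK// gt_eqF.
move=> H; suff : psi y + d * y ^+ 2 <
    psi a + (psi b - psi a) / (b - a) * (y - a) + (d * y ^+ 2 + e) by lra.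
apply: H.
  move=> s s0; apply: cvgD; first exact: cpsi.
  by apply: cvgM; [exact: cvg_cst|exact: csq].
move=> s r r0 rs.
have cs : continuous (fun t => (s + r * sin t) ^+ 2).
  by apply: (@continuous_height (fun s => s ^+ 2)) => // u _; exact: csq.
have -> : vertical_mean (fun s => psi s + d * s ^+ 2) s r =
    vertical_mean psi s r + d * vertical_mean (fun s => s ^+ 2) s r.
  rewrite /vertical_mean cintD ?cintZ//; first exact: continuous_height.
  by move=> t; apply: cvgM; [exact: cvg_cst|exact: cs].
rewrite mulrDr; apply: ler_ltD; first exact: sub.
by rewrite mulrCA ltr_pM2l//; exact: vertical_mean_sqr.
Qed.

(** Convexity of [expR (c * y) * M y] for every [c] lets the factor absorb any
ratio of values of [M], so a single zero forces [M] to vanish throughout. *)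
Lemma positive_of_exp_convex (M : R -> R) : (forall y, 0 < y -> 0 <= M y) ->
  (forall c a y b, 0 < a -> a < y -> y < b ->
    expR (c * y) * M y <= expR (c * a) * M a +
      (expR (c * b) * M b - expR (c * a) * M a) / (b - a) * (y - a)) ->
  forall y1 y0, 0 < y1 -> 0 < M y1 -> 0 < y0 -> 0 < M y0.
Proof.
move=> M0 Mcv y1 y0 y10 My1 y00; rewrite lt_neqAle M0// andbT eq_sym.
apply/eqP => My0.
(* On an interval that has the zero as one end and contains [y1], convexity bounds
   [M y1] by [expR (- (c * d)) * m] for all [c], where [d] is the distance from [y1]
   to the other end and [m] the value there; for large [c] this is less than
   [M y1]. *)
suff [d [m [d0 [m0 H]]]] : exists d m : R, 0 < d /\ 0 <= m /\
    forall c, M y1 <= expR (- (c * d)) * m.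
  pose c := (m / M y1) / d.
  have := H c; rewrite /c divfK ?gt_eqF// expRN => {}H.
  have q0 : 0 <= m / M y1 by rewrite divr_ge0// ltW.
  have E := expR_ge1Dx (m / M y1).
  have ep : 0 < expR (m / M y1) := expR_gt0 _.
  rewrite mulrC ler_pdivlMr// in H.
  have : M y1 * (1 + m / M y1) <= m by apply: le_trans H; rewrite ler_pM2l.
  by rewrite mulrDr mulr1 mulrCA divff ?gt_eqF//; lra.
case: (ltgtP y0 y1) => [y01|y01|E]; last by move: My1; rewrite -E My0 ltxx.
- exists 1, (M (y1 + 1)); split => //; split; first by apply: M0; lra.
  move=> c; have y1b : y1 < y1 + 1 by lra.
  have := Mcv (- c) y0 y1 (y1 + 1) y00 y01 y1b.
  rewrite My0 mulr0 subr0 add0r => H.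
  have q : (y1 - y0) / (y1 + 1 - y0) <= 1 by rewrite ler_pdivrMr; lra.
  have {}H : expR (- c * y1) * M y1 <= expR (- c * (y1 + 1)) * M (y1 + 1).
    apply: le_trans H _; rewrite mulrAC -mulrA ler_piMr// mulr_ge0 ?expR_ge0// M0//; lra.
  have e0 : 0 < expR (- c * y1) := expR_gt0 _.
  rewrite -(ler_pM2l e0) [leRHS]mulrA -expRD.
  by have -> : - c * y1 + - (c * 1) = - c * (y1 + 1) by ring.
- exists (y1 / 2), (M (y1 / 2)); split; first by rewrite divr_gt0.
  have h0 : 0 < y1 / 2 by rewrite divr_gt0.
  split; first exact: M0.
  move=> c; have h1 : y1 / 2 < y1 by lra.
  have := Mcv c (y1 / 2) y1 y0 h0 h1 y01.
  rewrite My0 mulr0 sub0r => H.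
  have {}H : expR (c * y1) * M y1 <= expR (c * (y1 / 2)) * M (y1 / 2).
    apply: le_trans H _; rewrite gerDl mulNr mulNr oppr_le0 mulr_ge0//; last lra.
    by rewrite divr_ge0 ?mulr_ge0 ?expR_ge0 ?M0//; lra.
  have e0 : 0 < expR (c * y1) := expR_gt0 _.
  rewrite -(ler_pM2l e0) [leRHS]mulrA -expRD.
  by have -> : c * y1 + - (c * (y1 / 2)) = c * (y1 / 2) by field.
Qed.

End SubMeanConvexity.

(** * The sub-mean value property of the line means *)

Section SubMeanOfHolomorphic.
Context {R : realType}.
Implicit Types (z w d : R[i]) (x y r c : R).
Local Notation nc := (@Normc.normc R).
Local Notation mu := (@lebesgue_measure R).
Local Notation T := (measurableTypeR R).

Variables (g g' : R[i] -> R[i]) (p : R).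
Hypothesis gd : forall z, 0 < complex.Im z -> cdiff g z (g' z).
Hypothesis p2 : 2 <= p.
Let U := line_pow g p.
Hypothesis iU : forall y, 0 < y -> mu.-integrable setT (EFin \o (fun x : T => U x y)).
Let K y := \int[mu]_x U x y.
Hypothesis cK : forall y, 0 < y -> {for y, continuous K}.

Let p1 : 1 <= p. Proof. by move: p2 => ?; lra. Qed.
Let p0 : 0 < p. Proof. by move: p2 => ?; lra. Qed.

Let EK y : 0 < y -> (\int[mu]_x (U x y)%:E)%E = (K y)%:E.
Proof.
move=> y0; have fi : (\int[mu]_x (EFin \o (fun x => U x y)) x)%E \is a fin_num.
  by apply: integrable_fin_num => //; exact: iU.
by rewrite /K /Rintegral fineK.
Qed.

Let EC y r : 0 < r -> r < y ->
  (\int[mu]_x (cint (circle_pow g p r y x))%:E)%E = (vertical_mean K y r)%:E.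
Proof.
move=> r0 ry; under eq_integral do rewrite (EFin_cint_circle gd p2)//.
rewrite tonelli_itv; last 2 first.
- by move=> x t; exact: line_pow_ge0.
- exact: (measurable_circle_pow gd p2).
under eq_integral.
  move=> t _; rewrite (integral_circle_shift gd p2)//.
  by rewrite EK; [over|exact: circle_height].
by rewrite EFin_Rintegral_itv// => t _; exact: continuous_height.
Qed.

(** The deficit in the sub-mean value property for the circle centred at [x + i y].
It is nonnegative, and its integral over [x] is the deficit of the line means. *)
Let excess r y x : R := cint (circle_pow g p r y x) - 2 * pi * U x y.

Let excess_ge0 r y x : 0 < r -> r < y -> 0 <= excess r y x.
Proof. by move=> r0 ry; rewrite subr_ge0; exact: (nc_mean_pow gd). Qed.

Let iC r y : 0 < r -> r < y ->
  mu.-integrable setT (EFin \o (fun x : T => cint (circle_pow g p r y x))).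
Proof.
move=> r0 ry; apply: (ge0_integrable (C := vertical_mean K y r)).
- by apply/measurable_EFinP; exact: (measurable_cint_circle_pow gd p2).
- by move=> x; apply: Rintegral_ge0 => t _; exact: line_pow_ge0.
- by rewrite EC.
Qed.

Let i2U y : 0 < y -> mu.-integrable setT (EFin \o (fun x : T => 2 * pi * U x y)).
Proof.
by move=> y0; have := integrableZl measurableT (2 * pi) (iU y0); apply: eq_integrable.
Qed.

Let iE r y : 0 < r -> r < y -> mu.-integrable setT (EFin \o (excess r y : T -> R)).
Proof.
move=> r0 ry; have y0 := lt_trans r0 ry.
by have := integrableB measurableT (iC r0 ry) (i2U y0); apply: eq_integrable.
Qed.

Let int_excess r y : 0 < r -> r < y ->
  \int[mu]_x excess r y x = vertical_mean K y r - 2 * pi * K y.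
Proof.
move=> r0 ry; have y0 := lt_trans r0 ry.
pose f1 (x : T) : R := cint (circle_pow g p r y x).
pose f2 (x : T) : R := 2 * pi * U x y.
have i1 : mu.-integrable setT (EFin \o f1) by exact: iC.
have i2 : mu.-integrable setT (EFin \o f2) by exact: i2U.
have E1 : \int[mu]_x (f1 x - f2 x) = \int[mu]_x f1 x - \int[mu]_x f2 x.
  by apply: RintegralB.
have E2 : \int[mu]_x f1 x = vertical_mean K y r by exact: (congr1 fine (EC r0 ry)).
have E3 : \int[mu]_x f2 x = 2 * pi * K y.
  by apply: (RintegralZl _ measurableT (iU y0)).
have E4 : \int[mu]_x excess r y x = \int[mu]_x (f1 x - f2 x) by [].
by rewrite E4 E1 E2 E3.
Qed.

Lemma submean y r : 0 < r -> r < y -> 2 * pi * K y <= vertical_mean K y r.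
Proof.
move=> r0 ry; rewrite -subr_ge0 -int_excess//; apply: Rintegral_ge0 => x _.
exact: excess_ge0.
Qed.

(** The integrated deficit vanishes, so the deficit is zero for almost every centre;
for these centres [nc_mean_pow_eq] applies, and continuity covers the others. *)
Let constant_circles r y : 0 < r -> r < y -> vertical_mean K y r <= 2 * pi * K y ->
  forall x t, 0 < t < 2 * pi -> g (circ (x +i* y) r t) = g (x +i* y).
Proof.
move=> r0 ry H; have y0 := lt_trans r0 ry.
have : (\int[mu]_x `|(excess r y x)%:E| = 0)%E.
  under eq_integral do rewrite gee0_abs ?lee_fin ?excess_ge0//.
  have fi : (\int[mu]_x (EFin \o excess r y) x)%E \is a fin_num.
    by apply: integrable_fin_num => //; exact: iE.
  rewrite -(fineK fi); congr EFin; apply/eqP; rewrite eq_le.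
  apply/andP; split; last by apply: Rintegral_ge0 => x _; exact: excess_ge0.
  by rewrite -[X in X <= _]/(\int[mu]_x excess r y x) int_excess// subr_le0.
have mE : measurable_fun setT (fun x : T => (excess r y x)%:E).
  exact: measurable_int (iE r0 ry).
move/ae_eq_integral_abs => {}H; have {mE}ae0 := H measurableT mE.
move=> x t tpi.
pose v x := nc (g (circ (x +i* y) r t) - g (x +i* y)).
suff : v x = 0 by move/Normc.eq0_normc/eqP; rewrite subr_eq0 => /eqP.
have cv : continuous v.
  move=> s; apply: ccont_nc; apply: ccontB; last exact: ccont_horiz (gd (z := s +i* y) y0).
  have yt := circle_height t r0 ry.
  move=> e e0.
  have h := @ccont_horiz R g (s + r * cos t) (y + r * sin t) _ (gd (z := _ +i* _) yt).
  have [del del0 Hd] := h e e0; exists del => // u ud.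
  by have := Hd u ud; rewrite /circ/= addrAC.
apply: (@ae_continuous_eq0 R v setT openT _ (fun s _ => cv s) x Logic.I).
apply: filterS ae0 => s /= Hs _.
have {}Hs : excess r y s = 0 by have [] := Hs Logic.I.
rewrite /v (_ : g (circ _ _ _) = g (s +i* y)) ?subrr ?nc0//.
apply: (nc_mean_pow_eq gd p2 r0 _ _ tpi) => //.
by move/eqP: Hs; rewrite /excess subr_eq0 => /eqP ->.
Qed.

(** If [g] is constant on each of these circles then, as neighbouring circles
meet, it is constant on the line, which contradicts integrability unless it
vanishes there. *)
Lemma strict_submean y r : 0 < r -> r < y -> 0 < K y ->
  2 * pi * K y < vertical_mean K y r.
Proof.
move=> r0 ry; have y0 := lt_trans r0 ry; move=> Ky; rewrite ltNge; apply: contraTN Ky => H.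
have cst := constant_circles r0 ry H.
have pi0 := pi_gt0 R.
have near x h : `|h| <= r -> g ((x + h) +i* y) = g (x +i* y).
  (* The circles of radius [r] about [x] and [x + h] meet above the midpoint of their
     centres, at the angles [t] and [pi - t]. *)
  move=> hr; pose q := h / (2 * r); pose t := acos q.
  have qr : `|q| <= 2^-1.
    have r2 : 0 < 2 * r by rewrite mulr_gt0.
    rewrite /q normrM normfV (ger0_norm (ltW r2)) ler_pdivrMr//; lra.
  have [q1 q2] : - 2^-1 <= q /\ q <= 2^-1 by move: qr; rewrite ler_norml => /andP.
  have t0 : 0 < t by apply: acos_gt0; apply/andP; split; lra.
  have tpi : t < pi by apply: acos_ltpi; apply/andP; split; lra.
  have ct : cos t = q by apply: acosK; rewrite in_itv/=; apply/andP; split; lra.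
  have rq : r * q = h / 2 by rewrite /q; field; rewrite gt_eqF.
  have <- : g (circ (x +i* y) r t) = g (x +i* y) by apply: cst; apply/andP; split; lra.
  have <- : g (circ ((x + h) +i* y) r (pi - t)) = g ((x + h) +i* y).
    by apply: cst; apply/andP; split; lra.
  have cpt : cos (pi - t) = - cos t by rewrite addrC cosDpi cosN.
  have spt : sin (pi - t) = sin t by rewrite addrC sinDpi sinN opprK.
  have E : x + h - h / 2 = x + h / 2 by field.
  by rewrite /circ/= cpt spt ct mulrN rq E.
have Ucst x : U x y = U 0 y.
  apply: (@is_derive_0_is_cst R (U^~ y)) => s.
  apply: eps_is_derive => e e0; exists r => // h hr.
  by rewrite /U /line_pow near// subrr mul0r subr0 normr0 mulr_ge0 ?normr_ge0 ?ltW.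
have : (\int[mu]_x (U x y)%:E)%E = (K y)%:E := EK y0.
under eq_integral do rewrite Ucst.
rewrite integral_cst//= -leNgt.
have -> : mu setT = +oo%E.
  by rewrite -set_itvNyy lebesgue_measure_itv/=.
have [U0|U0] := ltP 0 (U 0 y); first by rewrite gt0_muley ?lte_fin.
have -> : U 0 y = 0 by apply/eqP; rewrite eq_le U0 line_pow_ge0.
by rewrite mul0e => -[<-].
Qed.

End SubMeanOfHolomorphic.

Section StrictLogConvexity.
Context {R : realType}.
Implicit Types (z w d : R[i]) (x y r c a b : R).
Local Notation nc := (@Normc.normc R).
Local Notation mu := (@lebesgue_measure R).
Local Notation T := (measurableTypeR R).

Variables (f f' : R[i] -> R[i]) (p B : R).
Hypothesis fd : forall z, 0 < complex.Im z -> cdiff f z (f' z).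
Hypothesis p2 : 2 <= p.
Hypothesis B0 : 0 <= B.
Hypothesis HB : forall s, 0 < s -> (\int[mu]_x (line_pow f p x s)%:E <= B%:E)%E.
Let U := line_pow f p.
Definition line_mean y : R := \int[mu]_x line_pow f p x y.
Let M := line_mean.

Let p0 : 0 < p. Proof. by move: p2 => ?; lra. Qed.

Let iU y : 0 < y -> mu.-integrable setT (EFin \o (fun x : T => U x y)).
Proof. exact: line_integrable fd p2 HB y. Qed.

Lemma line_mean_ge0 y : 0 <= M y.
Proof. by apply: Rintegral_ge0 => x _; exact: line_pow_ge0. Qed.

Lemma line_mean_le y : 0 < y -> M y <= B.
Proof.
move=> y0; have fi : (\int[mu]_x (EFin \o (fun x => U x y)) x)%E \is a fin_num.
  by apply: integrable_fin_num => //; exact: iU.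
by have := HB y0; rewrite -(fineK fi) lee_fin.
Qed.

Lemma derivable_line_mean y : 0 < y -> derivable M y 1.
Proof. exact: derivable_mean fd p2 B0 HB y. Qed.

Lemma continuous_line_mean y : 0 < y -> {for y, continuous M}.
Proof. by move=> /derivable_line_mean/derivable1_diffP/differentiable_continuous. Qed.

Definition exp_mean c y : R := expR (c * y) * M y.

(** Multiplying [f] by a factor of modulus [expR (c y / p)] turns the weight
[expR (c y)] on line means into another holomorphic function. *)
Definition twist c z : R[i] := f z * cexp ((0 +i* (- (c / p))) * z).

Lemma cdiff_twist c : exists g', forall z, 0 < complex.Im z -> cdiff (twist c) z (g' z).
Proof.
pose a : R[i] := 0 +i* (- (c / p)).
exists (fun z => f' z * cexp (a * z) + f z * (cexp (a * z) * a)) => z z0.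
apply: (@cdiff_mul _ f (fun z => cexp (a * z))); first exact: fd.
by apply: (@cdiff_comp _ (fun z => a * z) cexp); [exact: cdiff_lin|exact: cdiff_cexp].
Qed.

Lemma line_pow_twist c x y : line_pow (twist c) p x y = expR (c * y) * U x y.
Proof.
rewrite /line_pow /twist ncM nc_cexp powRM ?nc_ge0 ?expR_ge0// mulrC; congr (_ * _).
rewrite /powR gt_eqF ?expR_gt0// expRK; congr expR => /=.
by field; rewrite gt_eqF.
Qed.

Lemma line_mean_twist c y : 0 < y -> \int[mu]_x line_pow (twist c) p x y = exp_mean c y.
Proof.
move=> y0; rewrite (_ : (fun x => line_pow (twist c) p x y) = (fun x => expR (c * y) * U x y)).
  exact: (RintegralZl _ measurableT (iU y0)).
by apply/funext => x; exact: line_pow_twist.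
Qed.

Lemma integrable_twist c y : 0 < y ->
  mu.-integrable setT (EFin \o (fun x : T => line_pow (twist c) p x y)).
Proof.
move=> y0; have := integrableZl measurableT (expR (c * y)) (iU y0).
by apply: eq_integrable => // x _ /=; rewrite line_pow_twist EFinM.
Qed.

Lemma continuous_exp_mean c y : 0 < y -> {for y, continuous (exp_mean c)}.
Proof.
move=> y0; apply: cvgM; last exact: continuous_line_mean.
apply: (@continuous_comp _ _ _ (fun y => c * y) expR); last exact: continuous_expR.
by apply: cvgM; [exact: cvg_cst|exact: cvg_id].
Qed.

Let K c y : R := \int[mu]_x line_pow (twist c) p x y.

Let cK c y : 0 < y -> {for y, continuous (K c)}.
Proof.
move=> y0; have := @continuous_exp_mean c y y0.
have E : K c y = exp_mean c y by exact: line_mean_twist.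
rewrite /prop_for /continuous_at E; apply: cvg_trans; apply: near_eq_cvg.
by near=> s; apply/esym/line_mean_twist; near: s; exact: lt_nbhsr.
Unshelve. all: by end_near. Qed.

Let vertical_mean_twist c y r : 0 < r -> r < y ->
  vertical_mean (K c) y r = vertical_mean (exp_mean c) y r.
Proof.
move=> r0 ry; apply: eq_Rintegral => t _.
by rewrite /K line_mean_twist//; exact: circle_height.
Qed.

Lemma submean_exp_mean c y r : 0 < r -> r < y ->
  2 * pi * exp_mean c y <= vertical_mean (exp_mean c) y r.
Proof.
move=> r0 ry; have [g' gd] := cdiff_twist c.
have := submean gd p2 (@integrable_twist c) (@cK c) r0 ry.
by rewrite -/(K c) vertical_mean_twist// line_mean_twist// (lt_trans r0).
Qed.

Lemma strict_submean_exp_mean c y r : 0 < r -> r < y -> 0 < M y ->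
  2 * pi * exp_mean c y < vertical_mean (exp_mean c) y r.
Proof.
move=> r0 ry My; have [g' gd] := cdiff_twist c; have y0 := lt_trans r0 ry.
have := strict_submean gd p2 (@integrable_twist c) (@cK c) r0 ry.
rewrite -/(K c) vertical_mean_twist// line_mean_twist//; apply.
by rewrite mulr_gt0 ?expR_gt0.
Qed.

Hypothesis f0 : exists z, 0 < complex.Im z /\ f z <> 0.

(** At the height of a point where [f] does not vanish the line mean is positive by
continuity; [positive_of_exp_convex] propagates this to every height. *)
Lemma line_mean_gt0 y : 0 < y -> 0 < M y.
Proof.
have [[x1 y1] /= [y10 fz]] := f0.
apply: (@positive_of_exp_convex R M _ _ y1) => //.
- by move=> s _; exact: line_mean_ge0.
- move=> c a s b a0 as_ sb; rewrite -!/(exp_mean c _).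
  apply: (convex_of_submean (@continuous_exp_mean c)) => //.
  by move=> s' r r0 rs; exact: submean_exp_mean.
rewrite lt_neqAle line_mean_ge0 andbT eq_sym; apply/eqP => M0; apply: fz.
suff : U x1 y1 = 0 by move/powR_eq0_eq0/Normc.eq0_normc.
have : (\int[mu]_x `|(U x y1)%:E| = 0)%E.
  under eq_integral do rewrite gee0_abs ?lee_fin ?line_pow_ge0//.
  have fi : (\int[mu]_x (EFin \o (fun x => U x y1)) x)%E \is a fin_num.
    by apply: integrable_fin_num => //; exact: iU.
  rewrite -(fineK fi); congr EFin; exact: M0.
have mE : measurable_fun setT (fun x : T => (U x y1)%:E) := measurable_int _ (iU y10).
move/ae_eq_integral_abs => H; have {mE H}ae0 := H measurableT mE.
apply: (@ae_continuous_eq0 R (U^~ y1) setT openT _ _ x1 Logic.I).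
  by apply: filterS ae0 => s /= Hs _; have [] := Hs Logic.I.
by move=> s _; exact: (continuous_line_pow_h fd p2).
Qed.

Lemma strict_convex_exp_mean c a y b : 0 < a -> a < y -> y < b ->
  exp_mean c y < exp_mean c a + (exp_mean c b - exp_mean c a) / (b - a) * (y - a).
Proof.
apply: (strict_convex_of_submean (@continuous_exp_mean c)) => s r r0 rs.
by apply: strict_submean_exp_mean => //; apply: line_mean_gt0; exact: lt_trans rs.
Qed.

End StrictLogConvexity.

(** * Averaging a strictly log-convex function against the exponential *)

Section ExpConvex.
Context {R : realType}.
Implicit Types (y t c a b : R).
Variables (M : R -> R) (B : R).
Hypothesis Mpos : forall y, 0 < y -> 0 < M y.
Hypothesis M_le : forall y, 0 < y -> M y <= B.
Let K c y := expR (c * y) * M y.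
Hypothesis Kconvex : forall c a y b, 0 < a -> a < y -> y < b ->
  K c y < K c a + (K c b - K c a) / (b - a) * (y - a).

(** A convex function that increases somewhere grows at least linearly from there on,
and so exceeds any bound. *)
Lemma exp_convex_nonincreasing y t : 0 < y -> y < t -> M t <= M y.
Proof.
move=> y0 yt; rewrite leNgt; apply/negP => Myt.
pose D := M t - M y; have D0 : 0 < D by rewrite subr_gt0.
have Bpos : 0 < B by exact: lt_le_trans (Mpos y0) (M_le y0).
have B1 : 0 < B / D + 1 by rewrite ltr_wpDl// divr_ge0// ltW.
(* The point at which linear growth from [(y, M y)] through [(t, M t)] reaches
   [M y + D + B], more than [M] can attain. *)
pose s := y + (t - y) * (B / D + 1).
have ty : 0 < t - y by rewrite subr_gt0.
have BD : 0 < B / D by rewrite divr_gt0.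
have ts : t < s.
  have E : s - t = (t - y) * (B / D) by rewrite /s; ring.
  by rewrite -subr_gt0 E mulr_gt0.
have s0 : 0 < s by apply: lt_trans ts; exact: lt_trans yt.
have E0 u : K 0 u = M u by rewrite /K mul0r expR0 mul1r.
have := @Kconvex 0 _ _ _ y0 yt ts; rewrite !E0.
have -> : (M s - M y) / (s - y) * (t - y) = (M s - M y) / (B / D + 1).
  have -> : s - y = (t - y) * (B / D + 1) by rewrite /s addrC addKr.
  by rewrite invfM mulrA mulrAC divfK ?gt_eqF.
rewrite -ltrBlDl -/D ltr_pdivlMr// mulrDr mulr1 mulrCA divff ?gt_eqF// mulr1.
have := M_le s0; have := Mpos y0; lra.
Qed.

Lemma exp_convex_decreasing y t : 0 < y -> y < t -> M t < M y.
Proof.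
move=> y0 yt; pose s := (y + t) / 2.
have [ys st] : y < s /\ s < t by rewrite /s; split; lra.
have s0 : 0 < s := lt_trans y0 ys.
apply: le_lt_trans (exp_convex_nonincreasing s0 st) _.
have E0 u : K 0 u = M u by rewrite /K mul0r expR0 mul1r.
have := @Kconvex 0 _ _ _ y0 ys st; rewrite !E0 => /lt_le_trans; apply.
rewrite gerDl mulr_le0_ge0 ?subr_ge0 ?(ltW ys)// mulr_le0_ge0 ?invr_ge0 ?subr_ge0 ?(ltW yt)//.
by rewrite subr_le0 exp_convex_nonincreasing.
Qed.

(** A strictly convex function lies strictly above its minimum.  If it did not at
[t], it would drop below its value at [y] already at the midpoint, and its slope
at [y] would be negative. *)
Lemma exp_convex_gt_critical c y t : 0 < y -> y < t ->
  is_derive y (1 : R) (K c) 0 -> K c y < K c t.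
Proof.
move=> y0 yt dK; rewrite ltNge; apply/negP => Kt.
pose s := (y + t) / 2.
have [ys st] : y < s /\ s < t by rewrite /s; split; lra.
have Ks : K c s < K c y.
  have := @Kconvex c _ _ _ y0 ys st => /lt_le_trans; apply.
  rewrite gerDl mulr_le0_ge0 ?subr_ge0 ?(ltW ys)// mulr_le0_ge0 ?invr_ge0 ?subr_ge0 ?(ltW yt)//.
  by rewrite subr_le0.
pose q := (K c y - K c s) / (s - y).
have q0 : 0 < q by rewrite divr_gt0 ?subr_gt0.
have [del del0 H] := is_derive_eps dK q0.
pose h := Num.min del ((s - y) / 2).
have h0 : 0 < h by rewrite lt_min del0 divr_gt0 ?subr_gt0.
have hd : `|h| <= del by rewrite gtr0_norm// ge_min lexx.
have hs : y + h < s.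
  have : h <= (s - y) / 2 by rewrite ge_min lexx orbT.
  by lra.
have yh : y < y + h by rewrite ltrDl.
have := H h hd; rewrite mul0r subr0 (gtr0_norm h0) ler_norml => /andP[+ _].
have E : (K c s - K c y) / (s - y) * (y + h - y) = - (q * h).
  by rewrite /q; field; rewrite subr_eq0 gt_eqF.
have := @Kconvex c _ _ _ y0 yh hs; rewrite E; lra.
Qed.

End ExpConvex.

Section ExponentialTail.
Context {R : realType}.
Implicit Types (y t a b : R).
Local Notation mu := (@lebesgue_measure R).

Lemma decreasing_of_derive (u : R -> R) a b : a < b ->
  (forall s, a <= s -> exists2 l : R, is_derive s (1 : R) u l & (a < s -> l < 0)) ->
  u b < u a.
Proof.
move=> ab H; have d s : a <= s -> derivable u s 1.
  by move=> /H[l dl _]; exact: ex_derive.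
have [||x xab E] := @MVT R u u^`() a b ab.
- move=> x; rewrite in_itv/= => /andP[ax _]; rewrite derive1E; apply/derivableP.
  exact/d/ltW.
- by apply: derivable_within_continuous => x; rewrite in_itv/= => /andP[ax _]; exact: d.
move: xab; rewrite in_itv/= => /andP[ax xb].
have [l dl l0] := H x (ltW ax).
by rewrite -subr_lt0 E nmulr_rlt0 ?subr_gt0// derive1E derive_val l0.
Qed.

Lemma is_derive_expRN (k t : R) :
  is_derive t (1 : R) (fun t => expR (- (k * t))) (- (k * expR (- (k * t)))).
Proof.
have d1 : is_derive t (1 : R) (fun t => - (k * t)) (- k).
  apply: is_deriveN; have := is_deriveZ k (is_derive_id t (1 : R)).
  by rewrite /GRing.scale/= mulr1.
have := @is_derive1_comp R expR (fun t => - (k * t)) t _ _ (is_derive_expR _) d1.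
by rewrite mulrN mulrC.
Qed.

Lemma is_derive_expN t : is_derive t (1 : R) (fun t => expR (- t)) (- expR (- t)).
Proof.
have := is_derive_expRN 1 t; rewrite !mul1r.
by under [X in is_derive _ _ X]eq_fun do rewrite mul1r.
Qed.

Lemma continuous_expN : continuous (fun t : R => expR (- t)).
Proof.
move=> t; apply: (@continuous_comp _ _ _ (fun t => - t) expR); last exact: continuous_expR.
exact: opp_continuous.
Qed.

Lemma integral_exp_tail y :
  (\int[mu]_(t in `]y, +oo[) (expR (- t))%:E)%E = (expR (- y))%:E.
Proof.
rewrite integral_itv_obnd_cbnd; last first.
  apply/measurable_EFinP; apply: measurable_funTS.
  by apply: continuous_measurable_fun; exact: continuous_expN.
rewrite (@ge0_continuous_FTC2y R _ (fun t => - expR (- t)) y 0).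
- by rewrite -EFinB sub0r opprK.
- by move=> t _; exact: expR_ge0.
- by apply: continuous_subspaceT; exact: continuous_expN.
- by rewrite -[X in _ --> X]oppr0; apply: cvgN; exact: cvgr_expR.
- by move=> t _; apply: derivableN; have [] := is_derive_expN t.
- by apply: cvg_at_right_filter; apply: cvgN; exact: continuous_expN.
- move=> t _; have := is_deriveN (is_derive_expN t).
  by move=> d; rewrite derive1E derive_val opprK.
Qed.

Lemma Rintegral_exp_tail y : \int[mu]_(t in `]y, +oo[) expR (- t) = expR (- y).
Proof. by rewrite /Rintegral integral_exp_tail. Qed.

Lemma integrable_exp_tail y : mu.-integrable `]y, +oo[ (EFin \o (fun t => expR (- t))).
Proof.
apply/integrableP; split.
  apply/measurable_EFinP; apply: measurable_funTS.
  by apply: continuous_measurable_fun; exact: continuous_expN.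
under eq_integral do rewrite gee0_abs ?lee_fin ?expR_ge0//.
by rewrite integral_exp_tail ltry.
Qed.

Lemma integrableZ_exp_tail (k : R) y :
  mu.-integrable `]y, +oo[ (fun t => (k%:E * (expR (- t))%:E)%E).
Proof. by apply: integrableZl => //; exact: integrable_exp_tail. Qed.

End ExponentialTail.

Section ExponentialAverage.
Context {R : realType}.
Implicit Types (y t c a b : R).
Local Notation mu := (@lebesgue_measure R).
Variables (M : R -> R) (B : R).
Hypothesis Mpos : forall y, 0 < y -> 0 < M y.
Hypothesis M_le : forall y, 0 < y -> M y <= B.
Hypothesis Mder : forall y, 0 < y -> derivable M y 1.
Hypothesis Mconvex : forall c a y b, 0 < a -> a < y -> y < b ->
  expR (c * y) * M y < expR (c * a) * M a +
    (expR (c * b) * M b - expR (c * a) * M a) / (b - a) * (y - a).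

Let cM y : 0 < y -> {for y, continuous M}.
Proof. by move=> /Mder/derivable1_diffP/differentiable_continuous. Qed.

Let w t : R := expR (- t) * M t.

Let cw t : 0 < t -> {for t, continuous w}.
Proof. by move=> t0; apply: cvgM; [exact: continuous_expN|exact: cM]. Qed.

Let iw y : 0 <= y -> mu.-integrable `]y, +oo[ (EFin \o w).
Proof.
move=> y0; have h := integrableZ_exp_tail B y.
apply: le_integrable h => //.
  apply/measurable_EFinP; apply: open_continuous_measurable_fun; first exact: interval_open.
  by move=> t; rewrite inE/= in_itv/= andbT => yt; apply: cw; exact: le_lt_trans yt.
move=> t; rewrite /= in_itv/= andbT => yt; have t0 : 0 < t by exact: le_lt_trans yt.
rewrite lee_fin /w !normrM mulrC ler_wpM2r// gtr0_norm ?Mpos//.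
by apply: le_trans (ler_norm _); exact: M_le.
Qed.

Definition exp_tail y : R := \int[mu]_(t in `]y, +oo[) (expR (- t) * M t).

Lemma exp_tail_ge0 y : 0 <= y -> 0 <= exp_tail y.
Proof.
move=> y0; apply: Rintegral_ge0 => t; rewrite /= in_itv/= andbT => yt.
by rewrite mulr_ge0 ?expR_ge0// ltW// Mpos//; exact: le_lt_trans yt.
Qed.

(** [exp_tail y] is [exp_tail 0] minus an integral over a bounded interval. *)
Lemma is_derive_exp_tail y : 0 < y -> is_derive y (1 : R) exp_tail (- (expR (- y) * M y)).
Proof.
move=> y0; have y1 : y < y + 1 by rewrite ltrDl.
pose F x := \int[mu]_(t in `]0%R, x]) w t.
have [||| d1 d2] := @continuous_FTC1 R w (BRight 0) y (y + 1) y1.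
- apply: integrableS (iw (lexx 0)) => //.
  by move=> t /=; rewrite !in_itv/= => /andP[->].
- exact: y0.
- exact: cw.
have dF : is_derive y (1 : R) F (w y).
  by apply: DeriveDef; [exact: d1|rewrite -derive1E; exact: d2].
have := is_deriveB (is_derive_cst (exp_tail 0) y (1 : R)) dF.
rewrite sub0r; apply: near_eq_is_derive; near=> s.
have s0 : 0 < s by near: s; exact: lt_nbhsr.
have := @Rintegral_itvB R w (BRight 0) +oo%O s (iw (lexx 0)).
by rewrite !bnd_simp (ltW s0) => /(_ isT isT).
Unshelve. all: by end_near. Qed.

Lemma exp_tail_le y : 0 < y -> exp_tail y <= expR (- y) * M y.
Proof.
move=> y0; rewrite -Rintegral_exp_tail -RintegralZr//; last exact: integrable_exp_tail.
apply: le_Rintegral => //; first exact/iw/ltW.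
  have h := integrableZ_exp_tail (M y) y.
  by apply: eq_integrable h => // t _ /=; rewrite -EFinM mulrC.
move=> t; rewrite /= in_itv/= andbT => yt; rewrite ler_wpM2l ?expR_ge0//.
by apply/ltW; exact: (exp_convex_decreasing Mpos M_le Mconvex).
Qed.

(** [expR (- s) * M y - exp_tail s] decreases strictly in [s >= y], and it is still
nonnegative at [s = y + 1]. *)
Lemma exp_tail_lt y : 0 < y -> exp_tail y < expR (- y) * M y.
Proof.
move=> y0; have y1 : y < y + 1 by rewrite ltrDl.
have y10 : 0 < y + 1 by lra.
have dec s : y < s -> M s < M y.
  by move=> ys; exact: (exp_convex_decreasing Mpos M_le Mconvex).
have : expR (- (y + 1)) * M y - exp_tail (y + 1) < expR (- y) * M y - exp_tail y.
  apply: (@decreasing_of_derive R (fun s => expR (- s) * M y - exp_tail s) _ _ y1) => s ys.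
  have s0 : 0 < s := lt_le_trans y0 ys.
  have d1 := is_deriveB (is_deriveM (is_derive_expN s) (is_derive_cst (M y) s (1 : R)))
    (is_derive_exp_tail s0).
  eexists; first exact: d1.
  move=> /dec My; rewrite /GRing.scale/= mulr0 add0r.
  by have := expR_gt0 (- s); nra.
have := exp_tail_le y10.
have : expR (- (y + 1)) * M (y + 1) < expR (- (y + 1)) * M y.
  by rewrite ltr_pM2l ?expR_gt0//; exact: dec.
lra.
Qed.

Lemma derive_le0 y : 0 < y -> derive1 M y <= 0.
Proof.
move=> y0; rewrite leNgt; apply/negP => m0.
have d : is_derive y (1 : R) M (derive1 M y) by rewrite derive1E; apply/derivableP/Mder.
have [del del0 H] := is_derive_eps d (divr_gt0 m0 (ltr0n R 2)).
have dd : `|del| <= del by rewrite gtr0_norm.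
have := H del dd; rewrite (gtr0_norm del0) ler_norml => /andP[+ _].
have yd : y < y + del by rewrite ltrDl.
have := exp_convex_decreasing Mpos M_le Mconvex y0 yd.
have : 0 < derive1 M y * del by rewrite mulr_gt0.
lra.
Qed.

(** With [c = - M' y / M y], the exponential that has the same value and slope as [M]
at [y] is [M y * expR (- c (t - y))]; it lies below [M] on the right of [y], by
strict convexity of [expR (c t) * M t], whose derivative vanishes at [y].  The
claim compares the two tail integrals. *)
Lemma exp_tail_gt y : 0 < y -> M y ^+ 2 * expR (- y) < exp_tail y * (M y - derive1 M y).
Proof.
move=> y0; have My := Mpos y0; have m0 := derive_le0 y0.
pose m := derive1 M y; pose c := - m / M y.
have c0 : 0 <= c by rewrite /c mulNr oppr_ge0 mulr_le0_ge0// invr_ge0 ltW.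
have c1 : 0 < 1 + c by rewrite ltr_wpDr.
have dM : is_derive y (1 : R) M m by rewrite /m derive1E; apply/derivableP/Mder.
have dK : is_derive y (1 : R) (fun s => expR (c * s) * M s) 0.
  have de : is_derive y (1 : R) (fun s => expR (c * s)) (c * expR (c * y)).
    have d1 : is_derive y (1 : R) (fun s => c * s) c.
      have := is_deriveZ c (is_derive_id y (1 : R)).
      by rewrite /GRing.scale/= mulr1.
    have := @is_derive1_comp R expR (fun s => c * s) y _ _ (is_derive_expR _) d1.
    by rewrite mulrC.
  apply: (is_derive_eq (is_deriveM de dM)).
  by rewrite /GRing.scale/= /c; field; rewrite gt_eqF.
have above s : y < s -> expR (c * y) * M y < expR (c * s) * M s.
  by move=> ys; exact: (exp_convex_gt_critical Mconvex y0 ys dK).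
pose k := M y * expR (c * y) / (1 + c).
have k0 : 0 < k by rewrite divr_gt0// mulr_gt0// expR_gt0.
(* [k * expR (- (1 + c) s)] is the tail integral of the comparison exponential, so
   [P] is the tail of a positive function: strictly decreasing and, as [exp_tail]
   is nonnegative, bounded below by quantities tending to zero. *)
pose P s := exp_tail s - k * expR (- ((1 + c) * s)).
have Pdec a b : y <= a -> a < b -> P b < P a.
  move=> ya ab; apply: decreasing_of_derive ab _ => s as_.
  have s0 : 0 < s by lra.
  have d1 := is_deriveB (is_derive_exp_tail s0) (is_deriveZ k (is_derive_expRN (1 + c) s)).
  eexists; first exact: d1.
  move=> as'; have ys : y < s := le_lt_trans ya as'.
  rewrite /GRing.scale/= mulrN opprK mulrCA.
  have -> : (1 + c) * (k * expR (- ((1 + c) * s))) = M y * expR (c * y) * expR (- ((1 + c) * s)).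
    by rewrite /k; field; rewrite gt_eqF.
  have -> : expR (- s) = expR (- ((1 + c) * s)) * expR (c * s).
    by rewrite -expRD; congr expR; ring.
  have e0 := expR_gt0 (- ((1 + c) * s)); have := above s ys.
  set E := expR (- ((1 + c) * s)) in e0 *.
  rewrite -subr_gt0 -(pmulr_rgt0 _ e0); lra.
have P1 : 0 <= P (y + 1).
  apply/ler_addgt0Pr => e e0.
  pose t := Num.max (y + 2) (k / ((1 + c) * e)).
  have yt : y + 1 < t by rewrite lt_max; apply/orP; left; lra.
  have t0 : 0 < t by lra.
  have Et : k * expR (- ((1 + c) * t)) <= e.
    rewrite expRN ler_pdivrMr ?expR_gt0//.
    apply: (@le_trans _ _ (e * ((1 + c) * t))).
      have : k / ((1 + c) * e) <= t by rewrite le_max lexx orbT.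
      rewrite ler_pdivrMr ?mulr_gt0//.
      by have -> : t * ((1 + c) * e) = e * ((1 + c) * t) by ring.
    rewrite ler_pM2l//; apply: le_trans (expR_ge1Dx _); lra.
  have := Pdec (y + 1) t _ yt; rewrite lerDl => /(_ ler01); rewrite {1}/P => h.
  have := exp_tail_ge0 (ltW t0); lra.
have : 0 < P y by apply: le_lt_trans P1 _; apply: Pdec => //; rewrite ltrDl.
rewrite /P subr_gt0 => H.
have Mm : 0 < M y - m by rewrite subr_gt0; exact: le_lt_trans My.
rewrite -(ltr_pM2r Mm) in H; apply: le_lt_trans H.
rewrite le_eqVlt; apply/orP; left; apply/eqP.
have -> : expR (- y) = expR (c * y) * expR (- ((1 + c) * y)).
  by rewrite -expRD; congr expR; ring.
rewrite /k /c; field; rewrite !gt_eqF//.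
Qed.

End ExponentialAverage.

Section ExponentialAverageRatio.
Context {R : realType}.
Implicit Types (y t c a b : R).
Variables (M : R -> R) (B : R).
Hypothesis Mpos : forall y, 0 < y -> 0 < M y.
Hypothesis M_le : forall y, 0 < y -> M y <= B.
Hypothesis Mder : forall y, 0 < y -> derivable M y 1.
Hypothesis Mconvex : forall c a y b, 0 < a -> a < y -> y < b ->
  expR (c * y) * M y < expR (c * a) * M a +
    (expR (c * b) * M b - expR (c * a) * M a) / (b - a) * (y - a).
Variable q : R -> R.
Hypothesis qE : forall y, 0 < y -> q y = expR y * exp_tail M y.

Let near_pos (u v : R -> R) y : 0 < y -> (forall s, 0 < s -> u s = v s) ->
  \forall s \near y, u s = v s.
Proof. by move=> y0 uv; near=> s; apply: uv; near: s; exact: lt_nbhsr.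
Unshelve. all: by end_near. Qed.

Let q_gt0 y : 0 < y -> 0 < q y.
Proof.
move=> y0; rewrite qE// mulr_gt0 ?expR_gt0// lt0r exp_tail_ge0// ?(ltW y0)// andbT.
apply/eqP => E; have := exp_tail_gt Mpos M_le Mder Mconvex y0.
by rewrite E mul0r ltNge mulr_ge0 ?sqr_ge0 ?expR_ge0.
Qed.

Let dq y : 0 < y -> is_derive y (1 : R) q (q y - M y).
Proof.
move=> y0; have near_q := near_pos y0 (fun s s0 => esym (qE s0)).
apply: near_eq_is_derive near_q _.
have d := is_deriveM (is_derive_expR y) (is_derive_exp_tail Mpos M_le Mder y0).
apply: (is_derive_eq d); rewrite /GRing.scale/= qE// mulrN mulrA -expRD subrr expR0 mul1r.
by rewrite addrC [exp_tail _ _ * _]mulrC.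
Qed.

Let dM y : 0 < y -> is_derive y (1 : R) M (derive1 M y).
Proof. by move=> /Mder y0; rewrite derive1E; apply/derivableP. Qed.

Let q'E y : 0 < y -> derive1 q y = q y - M y.
Proof. by move=> y0; have d := dq y0; rewrite derive1E derive_val. Qed.

Let dlnq y : 0 < y -> is_derive y (1 : R) (fun s => ln (q s)) (1 - M y / q y).
Proof.
move=> y0; have q0 := q_gt0 y0.
apply: (is_derive_eq (is_derive1_comp (is_derive1_ln q0) (dq y0))).
by field; rewrite gt_eqF.
Qed.

Let lnq'E y : 0 < y -> derive1 (fun s => ln (q s)) y = 1 - M y / q y.
Proof. by move=> y0; have d := dlnq y0; rewrite derive1E derive_val. Qed.

Let d2lnq y : 0 < y -> is_derive y (1 : R) (derive1 (fun s => ln (q s)))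
  ((q y * (M y - derive1 M y) - M y ^+ 2) / q y ^+ 2).
Proof.
move=> y0; have q0 := q_gt0 y0; have qn0 : q y != 0 by rewrite gt_eqF.
have near_l := near_pos y0 (fun s s0 => esym (lnq'E s0)).
apply: near_eq_is_derive near_l _.
have d := is_deriveB (is_derive_cst (1 : R) y (1 : R))
  (is_deriveM (dM y0) (is_deriveV qn0 (dq y0))).
by apply: (is_derive_eq d); rewrite /GRing.scale/=; field.
Qed.

Lemma ratio_D_class : D_class 2 `]0, +oo[ q.
Proof.
move=> k k2 y; rewrite /= in_itv/= andbT => y0.
case: k k2 => [_|[_|//]]; first by have [] := dq y0.
have near_q := near_pos y0 (fun s s0 => esym (q'E s0)).
apply: near_eq_derivable near_q _ => //.
by apply: derivableB; [have [] := dq y0|exact: Mder].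
Qed.

Lemma ln_ratio_D_class : D_class 2 `]0, +oo[ (fun y => ln (q y)).
Proof.
move=> k k2 y; rewrite /= in_itv/= andbT => y0.
by case: k k2 => [_|[_|//]]; [have [] := dlnq y0|have [] := d2lnq y0].
Qed.

Lemma ratio_derive_lt0 y : 0 < y -> derive1 q y < 0.
Proof.
move=> y0; rewrite q'E// qE// subr_lt0.
have -> : M y = expR y * (expR (- y) * M y) by rewrite mulrA -expRD subrr expR0 mul1r.
by rewrite ltr_pM2l ?expR_gt0//; exact: (exp_tail_lt Mpos M_le Mder Mconvex).
Qed.

Lemma ln_ratio_derive2_gt0 y : 0 < y -> 0 < derive1n 2 (fun y => ln (q y)) y.
Proof.
move=> y0; have q0 := q_gt0 y0; rewrite derive1nS derive1E.
have d := d2lnq y0; rewrite derive_val divr_gt0 ?exprn_gt0// subr_gt0 qE//.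
have -> : M y ^+ 2 = expR y * (M y ^+ 2 * expR (- y)).
  by rewrite mulrCA -expRD subrr expR0 mulr1.
by rewrite -mulrA ltr_pM2l ?expR_gt0//; exact: (exp_tail_gt Mpos M_le Mder Mconvex).
Qed.

End ExponentialAverageRatio.

Unset Implicit Arguments.

Theorem theorem15 (R : realType) (p : R) (f : R[i] -> R[i])
    (M phi h : R -> R)
    (hp : 2 <= p)
    (hf : hardy_space p f)
    (hf0 : exists z : R[i], upper_half_plane R z /\ f z <> 0)
    (hM : forall y : R, 0 < y ->
       M y = \int[@lebesgue_measure R]_x
               (Normc.normc (f (x +i* y)) `^ p))
    (hphi : forall y : R, 0 < y ->
       phi y = - \int[@lebesgue_measure R]_(t in `]y, +oo[) expR (- t))
    (hh : forall y : R, 0 < y ->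
       h y = - \int[@lebesgue_measure R]_(t in `]y, +oo[) (expR (- t) * M t)) :
  [/\ D_class 2 `]0, +oo[ (fun y => h y / phi y),
      D_class 2 `]0, +oo[ (fun y => ln (h y / phi y)),
      forall y : R, 0 < y -> (fun y => h y / phi y)^`() y < 0
    & forall y : R, 0 < y -> 0 < (fun y => ln (h y / phi y))^`(2) y].
Proof.
case: hf => hol sup_lty.
have /choice[f' fd] : forall z : R[i], exists d, 0 < complex.Im z -> cdiff f z d.
  move=> z; have [z0|z0] := ltP 0 (complex.Im z); last by exists 0.
  by have [d fd] := derivable_cdiff (hol z z0); exists d.
set sup := ereal_sup _ in sup_lty.
have le_sup s : 0 < s -> (\int[@lebesgue_measure R]_x (line_pow f p x s)%:E <= sup)%E.
  by move=> s0; apply: ereal_sup_ubound; exists s.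
have sup0 : (0 <= sup)%E.
  apply: le_trans (le_sup 1 ltr01); apply: integral_ge0 => x _.
  by rewrite lee_fin line_pow_ge0.
pose B := fine sup.
have supE : sup = B%:E by rewrite /B fineK// ge0_fin_numE.
have B0 : 0 <= B by rewrite /B fine_ge0.
have HB s : 0 < s -> (\int[@lebesgue_measure R]_x (line_pow f p x s)%:E <= B%:E)%E.
  by move=> s0; rewrite -supE; exact: le_sup.
have ME y : 0 < y -> M y = line_mean f p y := hM y.
have Mpos y : 0 < y -> 0 < M y.
  by move=> y0; rewrite ME//; exact: (line_mean_gt0 fd hp B0 HB hf0).
have M_le y : 0 < y -> M y <= B.
  by move=> y0; rewrite ME//; exact: (line_mean_le fd hp HB).
have Mder y : 0 < y -> derivable M y 1.
  move=> y0; have := derivable_line_mean fd hp B0 HB y0.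
  apply: near_eq_derivable => //.
  by near=> s; rewrite ME//; near: s; exact: lt_nbhsr.
have Mconvex c a y b : 0 < a -> a < y -> y < b ->
    expR (c * y) * M y < expR (c * a) * M a +
    (expR (c * b) * M b - expR (c * a) * M a) / (b - a) * (y - a).
  move=> a0 ay yb; have y0 := lt_trans a0 ay; rewrite !ME ?(lt_trans y0 yb)//.
  exact: (strict_convex_exp_mean fd hp B0 HB hf0 c a0 ay yb).
have qE y : 0 < y -> h y / phi y = expR y * exp_tail M y.
  move=> y0; rewrite hphi// hh// Rintegral_exp_tail invrN mulrNN expRN invrK.
  by rewrite mulrC.
split.
- exact: (ratio_D_class Mpos M_le Mder qE).
- exact: (ln_ratio_D_class Mpos M_le Mder Mconvex qE).
- exact: (ratio_derive_lt0 Mpos M_le Mder Mconvex qE).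
- exact: (ln_ratio_derive2_gt0 Mpos M_le Mder Mconvex qE).
Unshelve. all: by end_near. Qed.
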